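(* The group $\mathrm{SL}_4(\mathbb{Z})$ contains a non-split sharply 3-transitive subgroup, but the group $\mathrm{SL}_3(\mathbb{Z})$ does not contain an infinite sharply 3-transitive subgroup, whether split or non-split.
   Context: For an integer $n\geq 1$, an action of a group $G$ on a set $X$ with $|X|\geq n$ is sharply $n$-transitive if, for any two $n$-tuples of distinct elements of $X$, there exists a unique $g\in G$ mapping the first to the second. A group $G$ is called sharply $n$-transitive if there exists a set $X$ with a sharply $n$-transitive action of $G$ on $X$ (for a subgroup of $\mathrm{SL}_m(\mathbb{Z})$, $X$ is an arbitrary abstract set, unrelated to the linear action). A sharply 2-transitive group is split if it contains a non-trivial normal abelian subgroup, and non-split otherwise. If $G$ acts sharply 3-transitively on $X$, the stabiliser of a point of $X$ acts sharply 2-transitively on the remaining points, and is thus a sharply 2-transitive group; a sharply 3-transitive group is split if the stabiliser of a point is split, and non-split otherwise. (So a non-split sharply 3-transitive group is a group with a sharply 3-transitive action in which point stabilisers have no non-trivial normal abelian subgroup.) *)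

(* Defs.v *)
From HB Require Import structures.
From mathcomp Require Import all_boot all_order all_algebra.
From mathcomp Require Import all_classical.

Set Implicit Arguments.
Unset Strict Implicit.
Unset Printing Implicit Defensive.

Import GRing.Theory.

Local Open Scope classical_set_scope.
Local Open Scope ring_scope.

Definition SL (n : nat) (R : comUnitRingType) : Type :=
  {A : 'M[R]_n | \det A == 1}.

HB.instance Definition _ (n : nat) (R : comUnitRingType) :=
  Choice.on (SL n R).

Lemma SL_one_subproof (n : nat) (R : comUnitRingType) :
  \det (1%:M : 'M[R]_n) == 1.
Proof. by rewrite det1. Qed.

Lemma SL_mul_subproof (n : nat) (R : comUnitRingType) (A B : SL n R) :
  \det (val A *m val B) == 1.
Proof. by rewrite det_mulmx (eqP (valP A)) (eqP (valP B)) mulr1. Qed.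

Lemma SL_inv_subproof (n : nat) (R : comUnitRingType) (A : SL n R) :
  \det (invmx (val A)) == 1.
Proof. by rewrite det_inv (eqP (valP A)) invr1. Qed.

Definition SL_one (n : nat) (R : comUnitRingType) : SL n R :=
  exist _ 1%:M (SL_one_subproof n R).

Definition SL_mul (n : nat) (R : comUnitRingType) (A B : SL n R) : SL n R :=
  exist _ (val A *m val B) (SL_mul_subproof A B).

Definition SL_inv (n : nat) (R : comUnitRingType) (A : SL n R) : SL n R :=
  exist _ (invmx (val A)) (SL_inv_subproof A).

Lemma SL_unitmx (n : nat) (R : comUnitRingType) (A : SL n R) :
  val A \in unitmx.
Proof. by rewrite unitmxE (eqP (valP A)) unitr1. Qed.

Lemma SL_mulA (n : nat) (R : comUnitRingType) : associative (@SL_mul n R).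
Proof. by move=> A B C; apply: val_inj; rewrite /= mulmxA. Qed.

Lemma SL_mul1 (n : nat) (R : comUnitRingType) :
  left_id (SL_one n R) (@SL_mul n R).
Proof. by move=> A; apply: val_inj; rewrite /= mul1mx. Qed.

Lemma SL_mulr1 (n : nat) (R : comUnitRingType) :
  right_id (SL_one n R) (@SL_mul n R).
Proof. by move=> A; apply: val_inj; rewrite /= mulmx1. Qed.

Lemma SL_mulV (n : nat) (R : comUnitRingType) :
  left_inverse (SL_one n R) (@SL_inv n R) (@SL_mul n R).
Proof. by move=> A; apply: val_inj; rewrite /= mulVmx ?SL_unitmx. Qed.

Lemma SL_mulrV (n : nat) (R : comUnitRingType) :
  right_inverse (SL_one n R) (@SL_inv n R) (@SL_mul n R).
Proof. by move=> A; apply: val_inj; rewrite /= mulmxV ?SL_unitmx. Qed.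

HB.instance Definition _ (n : nat) (R : comUnitRingType) :=
  isGroup.Build (SL n R) (@SL_mulA n R) (@SL_mul1 n R) (@SL_mulr1 n R)
    (@SL_mulV n R) (@SL_mulrV n R).

Local Open Scope group_scope.

Definition subgroup (gT : groupType) (G : set gT) : Prop :=
  [/\ G 1,
      forall g h, G g -> G h -> G (g * h)
    & forall g, G g -> G g^-1].

(* Left action of the subgroup G on X: [act] is only constrained on G, its
   values outside G are irrelevant. *)
Definition is_action (gT : groupType) (G : set gT) (X : Type)
    (act : gT -> X -> X) : Prop :=
  (forall x, act 1 x = x) /\
  (forall g h x, G g -> G h -> act (g * h) x = act g (act h x)).

(* n-tuples of distinct elements are injections from 'I_n. *)
Definition sharply_transitive_action (n : nat) (gT : groupType) (G : set gT)
    (X : Type) (act : gT -> X -> X) : Prop :=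
  [/\ is_action G act,
      exists s : 'I_n -> X, injective s
    & forall s t : 'I_n -> X, injective s -> injective t ->
        exists! g : gT, G g /\ forall i, act g (s i) = t i].

Definition sharply_transitive (n : nat) (gT : groupType) (G : set gT) : Prop :=
  exists (X : Type) (act : gT -> X -> X), sharply_transitive_action n G act.

Definition stabiliser (gT : groupType) (G : set gT) (X : Type)
    (act : gT -> X -> X) (x : X) : set gT :=
  [set g | G g /\ act g x = x].

Definition normal_in (gT : groupType) (N G : set gT) : Prop :=
  [/\ subgroup N, N `<=` G & forall g x, G g -> N x -> N (x ^ g)].

Definition abelian_set (gT : groupType) (N : set gT) : Prop :=
  forall x y, N x -> N y -> x * y = y * x.

Definition split2 (gT : groupType) (G : set gT) : Prop :=
  exists N : set gT, [/\ normal_in N G, abelian_set N & N <> [set 1]].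

Definition split3_action (gT : groupType) (G : set gT) (X : Type)
    (act : gT -> X -> X) : Prop :=
  exists x : X, split2 (stabiliser G act x).

(* Being non-split refers to a given sharply 3-transitive action; the group is
   non-split when it has such an action. *)
Definition nonsplit_sharply3_transitive (gT : groupType) (G : set gT) : Prop :=
  exists (X : Type) (act : gT -> X -> X),
    sharply_transitive_action 3 G act /\ ~ split3_action G act.

(* Main.v *)
(** In a sharply 3-transitive group on an infinite set, an element of order 3
permuting a triple cyclically has an infinite centraliser: the centraliser acts
transitively on the points which are not fixed.  An element of order 3 of
SL_3(Z) is conjugate over Q to a 3-cycle, so its centraliser consists of the
circulant matrices with determinant 1 and entries in Z/3, of which there are
finitely many.

For SL_4(Z), let F be the free group on an S_3-set of letters in which every
proper subgroup of S_3 is the stabiliser of infinitely many letters.  The group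
F x| S_3 embeds in SL_4(Z) = SL_2(M_2(Z)): a letter b goes to the conjugate of
the lower shear by 2 under the upper shear by a matrix alpha_b, where S_3 acts
by conjugation and all differences alpha_b - alpha_b' expand norms (ping-pong).
It acts sharply 3-transitively on S_3/<t> + N x S_3, the action being built one
step at a time: partial actions of the letters are extended by sending points
to unused orbits, and a triple u which is not yet in the orbit of the base
triple x is joined to it by making a new letter with the right stabiliser map x
to u.  Freeness on triples is certified by an equivariant map lambda from
triples to the group, also equivariant for the relabelling of triples by S_3.
In such an action an element which swaps two points and fixes a third one has
only this fixed point and is odd.  A nontrivial element n of an abelian normal
subgroup of a point stabiliser coincides with the involution swapping y and n y
for some y, hence is odd; so there is only one such n, which is absurd. *)

From HB Require Import structures.
Require Import Defs.
From mathcomp Require Import all_boot all_order all_algebra.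
From mathcomp Require Import ring lra zify.
From mathcomp Require Import all_classical.

Set Implicit Arguments.
Unset Strict Implicit.
Unset Printing Implicit Defensive.

Import Order.TTheory GRing.Theory Num.Theory.

(** * The symmetric group on three points *)

Inductive pt : Set := p0 | p1 | p2.
Inductive s3 : Set := s3e | s3t01 | s3t12 | s3t02 | s3c | s3cc.

Definition pt_act (s : s3) (i : pt) : pt :=
  match s, i with
  | s3e, _ => i
  | s3t01, p0 => p1 | s3t01, p1 => p0 | s3t01, p2 => p2
  | s3t12, p0 => p0 | s3t12, p1 => p2 | s3t12, p2 => p1
  | s3t02, p0 => p2 | s3t02, p1 => p1 | s3t02, p2 => p0
  | s3c, p0 => p1 | s3c, p1 => p2 | s3c, p2 => p0
  | s3cc, p0 => p2 | s3cc, p1 => p0 | s3cc, p2 => p1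
  end.

(** The permutation sending [p0] to [i] and [p1] to [j]; the default branch covers [p2, p0] and the
    meaningless pairs [i = j]. *)
Definition s3_of (i j : pt) : s3 :=
  match i, j with
  | p0, p1 => s3e | p1, p0 => s3t01 | p0, p2 => s3t12
  | p2, p1 => s3t02 | p1, p2 => s3c | _, _ => s3cc
  end.

Definition s3_mul (s t : s3) : s3 :=
  s3_of (pt_act s (pt_act t p0)) (pt_act s (pt_act t p1)).

Definition s3_inv (s : s3) : s3 :=
  match s with s3c => s3cc | s3cc => s3c | _ => s end.

Definition s3_odd (s : s3) : bool :=
  match s with s3t01 | s3t12 | s3t02 => true | _ => false end.

Lemma pt_actM s t i : pt_act (s3_mul s t) i = pt_act s (pt_act t i).
Proof. by case: s; case: t; case: i. Qed.

Lemma s3_mulA s t r : s3_mul s (s3_mul t r) = s3_mul (s3_mul s t) r.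
Proof. by case: s; case: t; case: r. Qed.

Lemma s3_mul1s s : s3_mul s3e s = s. Proof. by case: s. Qed.
Lemma s3_muls1 s : s3_mul s s3e = s. Proof. by case: s. Qed.
Lemma s3_mulVs s : s3_mul (s3_inv s) s = s3e. Proof. by case: s. Qed.
Lemma s3_mulsV s : s3_mul s (s3_inv s) = s3e. Proof. by case: s. Qed.
Lemma s3_mulKV s t : s3_mul s (s3_mul (s3_inv s) t) = t.
Proof. by case: s; case: t. Qed.
Lemma s3_mulVK s t : s3_mul (s3_inv s) (s3_mul s t) = t.
Proof. by case: s; case: t. Qed.
Lemma s3_conj_neq1 s r : r <> s3e -> s3_mul s (s3_mul r (s3_inv s)) <> s3e.
Proof. by case: r; case: s => // h; case: h. Qed.
Lemma s3_oddM s t : s3_odd (s3_mul s t) = s3_odd s (+) s3_odd t.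
Proof. by case: s; case: t. Qed.

Lemma pt_actK s : cancel (pt_act s) (pt_act (s3_inv s)).
Proof. by case: s; case. Qed.
Lemma pt_actKV s : cancel (pt_act (s3_inv s)) (pt_act s).
Proof. by case: s; case. Qed.
Lemma pt_act_inj s : injective (pt_act s). Proof. exact: can_inj (pt_actK s). Qed.

Lemma pt_act_faithful s : (forall i, pt_act s i = i) -> s = s3e.
Proof. by move=> h; move: (h p0) (h p1) (h p2); case: s h. Qed.

Lemma pt_fix_unique r i j :
  r <> s3e -> pt_act r i = i -> pt_act r j = j -> i = j.
Proof. by case: r; case: i; case: j. Qed.

Lemma pt_injP (f : pt -> pt) : injective f -> exists s, f =1 pt_act s.
Proof.
move=> fI; exists (s3_of (f p0) (f p1)).
have n01 : f p0 <> f p1 by move/fI.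
have n02 : f p0 <> f p2 by move/fI.
have n12 : f p1 <> f p2 by move/fI.
by case; move: n01 n02 n12; case: (f p0); case: (f p1); case: (f p2).
Qed.

Definition s3_code (s : s3) : nat :=
  match s with
  | s3e => 0 | s3t01 => 1 | s3t12 => 2 | s3t02 => 3 | s3c => 4 | s3cc => 5
  end.
Definition s3_decode (n : nat) : option s3 :=
  match n with
  | 0 => Some s3e | 1 => Some s3t01 | 2 => Some s3t12 | 3 => Some s3t02
  | 4 => Some s3c | 5 => Some s3cc | _ => None
  end.
Lemma s3_codeK : pcancel s3_code s3_decode. Proof. by case. Qed.
HB.instance Definition _ := Countable.copy s3 (pcan_type s3_codeK).

Definition pt_code (i : pt) : nat :=
  match i with p0 => 0 | p1 => 1 | p2 => 2 end.
Definition pt_decode (n : nat) : option pt :=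
  match n with 0 => Some p0 | 1 => Some p1 | 2 => Some p2 | _ => None end.
Lemma pt_codeK : pcancel pt_code pt_decode. Proof. by case. Qed.
HB.instance Definition _ := Countable.copy pt (pcan_type pt_codeK).

Definition space : Type := (pt + nat * s3)%type.
HB.instance Definition _ := Countable.on space.

Definition act (s : s3) (p : space) : space :=
  match p with
  | inl i => inl (pt_act s i)
  | inr (n, r) => inr (n, s3_mul s r)
  end.

Lemma act1 p : act s3e p = p.
Proof. by case: p => [i|[n r]] //=; rewrite s3_mul1s. Qed.
Lemma actM s t p : act (s3_mul s t) p = act s (act t p).
Proof. by case: p => [i|[n r]] /=; rewrite ?pt_actM ?s3_mulA. Qed.
Lemma actK s : cancel (act s) (act (s3_inv s)).
Proof. by move=> p; rewrite -actM s3_mulVs act1. Qed.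
Lemma actKV s : cancel (act (s3_inv s)) (act s).
Proof. by move=> p; rewrite -actM s3_mulsV act1. Qed.
Lemma act_inj s : injective (act s). Proof. exact: can_inj (actK s). Qed.

Lemma act_fix r p : r <> s3e -> act r p = p ->
  exists2 i, p = inl i & pt_act r i = i.
Proof.
case: p => [i|[n s]] /= rN; first by case=> h; exists i.
by case=> h; case: rN; move: h; case: r; case: s.
Qed.

Definition level (p : space) : nat := if p is inr (n, _) then n.+1 else 0.

Lemma level_act s p : level (act s p) = level p.
Proof. by case: p => [|[]]. Qed.

(* Types of letters according to their stabiliser in S_3: the alternating group,
   the stabiliser of a point, or the trivial group. *)
Inductive kind : Set := Kalt of bool | Kpt of pt | Kfree of s3.

Definition kind_act (s : s3) (k : kind) : kind :=
  match k with
  | Kalt b => Kalt (s3_odd s (+) b)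
  | Kpt i => Kpt (pt_act s i)
  | Kfree r => Kfree (s3_mul s r)
  end.

Lemma kind_act1 k : kind_act s3e k = k.
Proof. by case: k => // r /=; rewrite s3_mul1s. Qed.
Lemma kind_actM s t k : kind_act (s3_mul s t) k = kind_act s (kind_act t k).
Proof. by case: k => [b|i|r] /=; rewrite ?s3_oddM ?addbA ?pt_actM ?s3_mulA. Qed.

Definition kind_code (k : kind) : bool + (pt + s3) :=
  match k with Kalt b => inl b | Kpt i => inr (inl i) | Kfree r => inr (inr r) end.
Definition kind_decode (x : bool + (pt + s3)) : kind :=
  match x with inl b => Kalt b | inr (inl i) => Kpt i | inr (inr r) => Kfree r end.
Lemma kind_codeK : cancel kind_code kind_decode. Proof. by case. Qed.
HB.instance Definition _ := Countable.copy kind (can_type kind_codeK).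

Lemma s3_generate (D : s3 -> Prop) s :
  (forall s t, D s -> D t -> D (s3_mul s t)) ->
  s3_odd s -> D s -> D s3c -> forall t, D t.
Proof.
move=> DM od Ds Dc; have Dcc := DM _ _ Dc Dc; have De := DM _ _ Dc Dcc.
have Dsc := DM _ _ Ds Dc; have Dscc := DM _ _ Ds Dcc.
by case: s od Ds Dsc Dscc => // _ ? ? ?; case.
Qed.

Lemma s3_odd_even s t : s3_odd s -> s3_odd t -> s <> t ->
  ~~ s3_odd (s3_mul s t) /\ s3_mul s t <> s3e.
Proof. by case: s; case: t. Qed.

Lemma s3_conj_odd s t u : s3_odd s -> s3_odd t -> ~~ s3_odd u -> u <> s3e ->
  exists r, s3_mul r s = s3_mul t r /\ s3_mul r s3c = s3_mul u r.
Proof.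
case: s; case: t => // _ _; case: u => // _ _;
  first [by exists s3e | by exists s3t01 | by exists s3t12
       | by exists s3t02 | by exists s3c | by exists s3cc].
Qed.

(* An isomorphism between two subgroups of S_3 is the restriction of an inner
   automorphism. *)
Lemma s3_inner (C : s3 -> s3 -> Prop) :
  (forall s t s' t', C s t -> C s' t' -> C (s3_mul s s') (s3_mul t t')) ->
  (forall s t t', C s t -> C s t' -> t = t') ->
  (forall s s' t, C s t -> C s' t -> s = s') ->
  exists r, forall s t, C s t -> s3_mul r s = s3_mul t r.
Proof.
move=> CM Cf Ci.
have Ce t : C s3e t -> t = s3e.
  by move=> h; have := Cf _ _ _ (CM _ _ _ _ h h) h; case: (t).
have Ce' s : C s s3e -> s = s3e.
  by move=> h; have := Ci _ _ _ (CM _ _ _ _ h h) h; case: (s).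
(* Exactly 1 and the transpositions have trivial square, so [C] preserves parity. *)
have sqE s : s3_mul s s = s3e <-> s = s3e \/ s3_odd s.
  by case: s; split=> //; try (by left); try (by right); case.
have Codd s t : C s t -> s3_odd s = s3_odd t.
  move=> h; have h2 := CM _ _ _ _ h h; apply/idP/idP => od.
    have [|e|//] := (sqE t).1; last by subst t; rewrite (Ce' _ h) in od.
    by apply: Ce; rewrite -((sqE s).2 (or_intror od)).
  have [|e|//] := (sqE s).1; last by subst s; rewrite (Ce _ h) in od.
  by apply: Ce'; rewrite -((sqE t).2 (or_intror od)).
(* [D r] is the set where [C] agrees with conjugation by [r]. It is closed under products, so only
   generators of the domain of [C] have to be checked. *)
pose D r s := exists2 t, C s t & s3_mul r s = s3_mul t r.
have DM r s t : D r s -> D r t -> D r (s3_mul s t).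
  move=> [s' Cs es] [t' Ct et]; exists (s3_mul s' t'); first exact: CM.
  by rewrite s3_mulA es -s3_mulA et s3_mulA.
suff [r Dr] : exists r, forall s t, C s t -> D r s.
  by exists r => s t Cst; have [t' Cst' ->] := Dr _ _ Cst; rewrite (Cf _ _ _ Cst Cst').
have [[s [t [Cst od]]]|noodd] := pselect (exists s t, C s t /\ s3_odd s).
  have odt : s3_odd t by rewrite -(Codd _ _ Cst).
  have [[u Cu]|noc] := pselect (exists u, C s3c u).
    have u_even : ~~ s3_odd u by rewrite -(Codd _ _ Cu).
    have [|r [rs rc]] := s3_conj_odd od odt u_even.
      by move=> e; subst u; have := Ce' _ Cu.
    by exists r => ? _ _; apply: (s3_generate (DM r) od); [exists t|exists u].
  have [r [rs _]] := s3_conj_odd (u := s3c) od odt isT (fun h => ltac:(by [])).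
  exists r => s1 t1 C1; have [<-|ne] := pselect (s = s1); first by exists t.
  have [od1|ev1] := boolP (s3_odd s1); last first.
    case: s1 ev1 C1 ne => // _ C1 _.
    - by have e := Ce _ C1; subst t1; exists s3e; rewrite ?s3_muls1 ?s3_mul1s.
    - by case: noc; exists t1.
    - by case: noc; exists (s3_mul t1 t1); exact: (CM _ _ _ _ C1 C1).
  have Cs := CM _ _ _ _ Cst C1; have Css := CM _ _ _ _ Cs Cs.
  have [] := s3_odd_even od od1 ne.
  case E : (s3_mul s s1) => // _ _; case: noc; rewrite E in Cs Css.
    by exists (s3_mul t t1).
  by exists (s3_mul (s3_mul t t1) (s3_mul t t1)).
have Ceven s t : C s t -> s = s3e \/ s = s3c \/ s = s3cc.
  move=> Cst; have : ~ s3_odd s by move=> od; apply: noodd; exists s, t.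
  by case: s {Cst} => // _; tauto.
have [[u Cu]|noc] := pselect (exists u, C s3c u).
  have u_even : ~~ s3_odd u by rewrite -(Codd _ _ Cu).
  have [|r [_ rc]] := s3_conj_odd (s := s3t01) (t := s3t01) isT isT u_even.
    by move=> e; subst u; have := Ce' _ Cu.
  have Dc : D r s3c by exists u.
  exists r => s t /Ceven [|[]] e; subst s => //; last exact: (DM _ _ _ Dc Dc).
  exact: (DM _ _ _ Dc (DM _ _ _ Dc Dc)).
exists s3e => s t Cst; have [e|[e|e]] := Ceven _ _ Cst; subst s.
- by have e := Ce _ Cst; subst t; exists s3e.
- by case: noc; exists t.
- by case: noc; exists (s3_mul t t); exact: (CM _ _ _ _ Cst Cst).
Qed.

(** A transposition together with a second one or with a 3-cycle generates S_3. So [R] is generated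
    by one transposition, alternating or trivial, which are the three cases of [kind]. *)
Lemma kind_stabiliser (R : s3 -> Prop) :
  R s3e -> (forall s t, R s -> R t -> R (s3_mul s t)) ->
  (exists s, ~ R s) -> exists k, forall s, kind_act s k = k <-> R s.
Proof.
move=> R1 RM [s0 Rs0].
have full s : s3_odd s -> R s -> R s3c -> False.
  by move=> od Rs Rc; apply: Rs0; exact: s3_generate RM od Rs Rc s0.
have Rcc : R s3cc -> R s3c by move=> h; exact: (RM _ _ h h).
have [[s [Rs od]]|noodd] := pselect (exists s, R s /\ s3_odd s).
  have [i si] : exists i, pt_act s i = i by case: (s) od; [|exists p2|exists p0|exists p1|..].
  exists (Kpt i) => t; split=> [[ti]|Rt].
    have [->//|tn] := pselect (t = s3e); suff -> : t = s by [].
    by case: (t) (s) (i) od tn si ti => -[] // [].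
  congr Kpt; have [<-//|ne] := pselect (s = t).
  have [od1|ev1] := boolP (s3_odd t).
    have := RM _ _ Rs Rt; have [] := s3_odd_even od od1 ne.
    by case: s3_mul => // _ _ h; case: (full _ od Rs); auto.
  by case: (t) ev1 Rt => // _ h; case: (full _ od Rs); auto.
have ev t : R t -> ~~ s3_odd t.
  by move=> Rt; apply/negP=> od; apply: noodd; exists t.
have [Rc|Rc] := pselect (R s3c).
  have := RM _ _ Rc Rc => /= Rc2.
  exists (Kalt true) => t; split=> [[]|/ev /negbTE /= -> //].
  by case: t.
exists (Kfree s3e) => t; rewrite /= s3_muls1; split=> [[->//]|Rt].
by have := ev _ Rt; case: t Rt => // /Rcc.
Qed.

(** * Partial actions *)

Local Open Scope group_scope.

Definition letter : Type := (nat * kind)%type.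
HB.instance Definition _ := Countable.on letter.

Definition lact (s : s3) (b : letter) : letter := (b.1, kind_act s b.2).

Lemma lact1 b : lact s3e b = b.
Proof. by case: b => n k; rewrite /lact kind_act1. Qed.
Lemma lactM s t b : lact (s3_mul s t) b = lact s (lact t b).
Proof. by rewrite /lact kind_actM. Qed.
Lemma lactK s : cancel (lact s) (lact (s3_inv s)).
Proof. by move=> b; rewrite -lactM s3_mulVs lact1. Qed.
Lemma lactKV s : cancel (lact (s3_inv s)) (lact s).
Proof. by move=> b; rewrite -lactM s3_mulsV lact1. Qed.

Definition triple : Type := pt -> space.

Definition base : triple := inl.

Lemma base_act s : base \o pt_act s = act s \o base.
Proof. by []. Qed.

Lemma comp_act1 (I : Type) (t : I -> space) : act s3e \o t = t.
Proof. by apply/funext => i /=; rewrite act1. Qed.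
Lemma comp_actM (I : Type) s r (t : I -> space) :
  act (s3_mul s r) \o t = act s \o (act r \o t).
Proof. by apply/funext => i /=; rewrite actM. Qed.
Lemma comp_actK (I : Type) s (t : I -> space) : act (s3_inv s) \o (act s \o t) = t.
Proof. by rewrite -comp_actM s3_mulVs comp_act1. Qed.
Lemma comp_pt1 (t : triple) : t \o pt_act s3e = t.
Proof. exact/funext. Qed.
Lemma comp_ptM s r (t : triple) :
  t \o pt_act (s3_mul s r) = (t \o pt_act s) \o pt_act r.
Proof. by apply/funext => i /=; rewrite pt_actM. Qed.
Lemma comp_ptK s (t : triple) : (t \o pt_act s) \o pt_act (s3_inv s) = t.
Proof. by rewrite -comp_ptM s3_mulsV comp_pt1. Qed.

Lemma act_comp_inj (t : triple) s : injective t -> injective (act s \o t).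
Proof. by move=> tI; exact: inj_comp (@act_inj s) tI. Qed.
Lemma pt_comp_inj (t : triple) s : injective t -> injective (t \o pt_act s).
Proof. by move=> tI; exact: inj_comp tI (@pt_act_inj s). Qed.

Lemma act_triple_fix s (t : triple) : injective t -> act s \o t = t -> s = s3e.
Proof.
move=> tI /funeqP st; have [//|sN] := pselect (s = s3e).
have [i ei hi] := act_fix sN (st p0); have [j ej hj] := act_fix sN (st p1).
by have := pt_fix_unique sN hi hj => e; subst j; have := tI p0 p1; rewrite ei ej => /(_ erefl).
Qed.

(** [E b p q] is read as: the partial bijection attached to the letter [b] sends [p] to [q]. *)
Definition edges : Type := letter -> space -> space -> Prop.

(* A letter fixed by a transposition must fix the unique fixed point of that
   transposition. *)
Definition forced (b : letter) (p q : space) : Prop :=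
  p = q /\ exists r, [/\ r <> s3e, lact r b = b & act r p = p].

Definition edges_op (E : edges) : edges := fun b p q => E b q p.

Record partial_bij (E : edges) : Prop := PartialBij {
  pb_fun : forall b p q q', E b p q -> E b p q' -> q = q';
  pb_inj : forall b p p' q, E b p q -> E b p' q -> p = p';
  pb_act : forall s b p q, E b p q -> E (lact s b) (act s p) (act s q) }.

(** The single bound [N] controls both the orbits met by edges and the letters with edges beyond the
    forced ones, so fresh orbits and fresh letters are available above it. *)
Record finitary (E : edges) (N : nat) : Prop := Finitary {
  fin_bij :> partial_bij E;
  fin_forced : forall b p q, forced b p q -> E b p q;
  fin_level : forall b p q, E b p q -> (level p <= N)%N /\ (level q <= N)%N;
  fin_new : forall b p q, E b p q -> (N <= b.1)%N -> forced b p q }.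

Lemma forced_op b p q : forced b p q -> forced b q p.
Proof. by move=> [-> [r []]]; split=> //; exists r. Qed.

Lemma finitary_op E N : finitary E N -> finitary (edges_op E) N.
Proof.
move=> [[h1 h2 h3] h4 h5 h6]; split=> //.
- split=> //; [by move=> b p q q'; exact: h2|by move=> b p p' q; exact: h1|].
  by move=> s b p q; exact: h3.
- by move=> b p q /forced_op; exact: h4.
- by move=> b p q /h5[].
- by move=> b p q /h6/[apply]/forced_op.
Qed.

Lemma pb_act_iff E s b p q : partial_bij E ->
  E (lact s b) (act s p) (act s q) <-> E b p q.
Proof.
move=> pE; split=> [h|]; last exact: (pb_act pE).
by have := pb_act pE (s3_inv s) h; rewrite lactK !actK.
Qed.

Lemma forced_act s b p q : forced b p q -> forced (lact s b) (act s p) (act s q).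
Proof.
move=> [-> [r [rN rb rq]]]; split=> //; exists (s3_mul s (s3_mul r (s3_inv s))).
split; first exact: s3_conj_neq1.
  by rewrite !lactM lactK rb.
by rewrite !actM actK rq.
Qed.

Lemma forced_fix b p q : forced b p q -> exists r i,
  [/\ p = inl i, q = inl i, r <> s3e, lact r b = b & pt_act r i = i].
Proof. by move=> [<- [r [rN rb /(act_fix rN)[i -> ri]]]]; exists r, i. Qed.

(** * Labellings of triples and the addition of one edge *)

Section Labellings.
Variables (gT : groupType) (iota : s3 -> gT).

Definition compatible (beta : letter -> gT) : Prop :=
  forall s b, iota s * beta b = beta (lact s b) * iota s.

(** The certificate of freeness on triples: moving along a word multiplies the label on the left by
    this word, so a word which fixes a triple is trivial in the group. *)
Record labelling (beta : letter -> gT) (E : edges) (lam : triple -> gT) : Prop :=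
  Labelling {
  lab_left : forall s t, injective t -> lam (act s \o t) = iota s * lam t;
  lab_right : forall s t, injective t -> lam (t \o pt_act s) = lam t * iota s;
  lab_edge : forall b t t', injective t -> injective t' ->
    (forall i, E b (t i) (t' i)) -> lam t' = beta b * lam t;
  lab_base : lam base = 1 }.

Lemma compatible_inv beta : compatible beta -> compatible (fun b => (beta b)^-1).
Proof.
move=> hb s b; apply: (mulgI (beta (lact s b))).
by rewrite mulgA -hb mulgK mulVKg.
Qed.

Lemma labelling_op beta E lam : labelling beta E lam ->
  labelling (fun b => (beta b)^-1) (edges_op E) lam.
Proof.
move=> [h1 h2 h3 h4]; split=> // b t t' tI t'I h.
by rewrite (h3 b t' t) // mulKg.
Qed.

Definition fresh (n : nat) : space := inr (n, s3e).

Lemma act_fresh s n : act s (fresh n) = inr (n, s).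
Proof. by rewrite /= s3_muls1. Qed.

(* Adding one edge out of [p], towards a free orbit which was not used before. *)
Lemma extend_forward (Q : gT -> Prop) beta E lam N b p : compatible beta ->
  finitary E N -> labelling beta E lam ->
  (forall t, Q (lam t)) -> (forall s g, Q g -> Q (beta (lact s b) * g)) ->
  exists E' lam' N', [/\ [/\ forall b p q, E b p q -> E' b p q, finitary E' N',
    labelling beta E' lam' & forall t, Q (lam' t)],
    forall t : triple, (forall i, level (t i) <= N)%N -> lam' t = lam t
  & exists q, E' b p q].
Proof.
move=> cb pE lE lQ Qb.
have [[q bpq]|undef] := pselect (exists q, E b p q).
  by exists E, lam, N; split=> //; exists q.
(* The level [n.+1] exceeds [N] and the level of [p], so the fresh orbit meets no edge of [E] and
   contains no source of a new edge. *)
pose n := (N + level p)%N.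
have nN x : level x = n.+1 -> (N < level x)%N by move=> ->; rewrite ltnS leq_addr.
have levf s : level (act s (fresh n)) = n.+1 by rewrite level_act.
have undef' s q : ~ E (lact s b) (act s p) q.
  move=> h; apply: undef; exists (act (s3_inv s) q).
  by apply/(pb_act_iff s _ _ _ pE); rewrite actKV.
(* If a nontrivial permutation fixed both [b] and [p], the forced edge at [p] would already be in
   [E]. Hence S_3 acts freely on the new edges. *)
have nfix s s' : lact s b = lact s' b -> act s p = act s' p -> s = s'.
  move=> hb hp; pose r := s3_mul (s3_inv s) s'.
  have [r1|rN] := pselect (r = s3e).
    by rewrite -(s3_muls1 s) -r1 s3_mulKV.
  case: undef; exists p; apply: (fin_forced pE); split=> //; exists r.
  by rewrite /r lactM -hb lactK actM -hp actK.
pose new b' p' q' := exists s, [/\ b' = lact s b, p' = act s p & q' = act s (fresh n)].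
pose E' b' p' q' := E b' p' q' \/ new b' p' q'.
have oldlev b' p' q' : E b' p' q' -> level p' <> n.+1 /\ level q' <> n.+1.
  by move=> /(fin_level pE)[h1 h2]; split=> /nN; rewrite ltnNge ?h1 ?h2.
have srclev b' p' q' : E' b' p' q' -> level p' <> n.+1.
  move=> [/oldlev[]//|[s [_ -> _]]]; rewrite level_act => e.
  by have := leq_addl N (level p); rewrite -/n e ltnn.
have pE' : finitary E' (maxn n.+1 b.1.+1).
  split; first split.
  - move=> b' p' q q' [h|[s [e1 e2 e3]]] [h'|[s' [e1' e2' e3']]].
    + exact: pb_fun pE _ _ _ _ h h'.
    + by subst; case: (undef' _ _ h).
    + by subst; case: (undef' _ _ h').
    + by subst; rewrite (nfix _ _ e1' e2').
  - move=> b' p' p'' q [h|[s [e1 e2 e3]]] [h'|[s' [e1' e2' e3']]].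
    + exact: pb_inj pE _ _ _ _ h h'.
    + by case: (oldlev _ _ _ h) => _; rewrite e3' levf.
    + by case: (oldlev _ _ _ h') => _; rewrite e3 levf.
    + by subst; move: e3'; rewrite !act_fresh => -[->].
  - move=> s b' p' q [h|[s' [-> -> ->]]]; first by left; exact: (pb_act pE).
    by right; exists (s3_mul s s'); rewrite lactM !actM.
  - by move=> *; left; exact: (fin_forced pE).
  - move=> b' p' q [/(fin_level pE)[h1 h2]|[s [_ -> ->]]].
      have Nn : (N <= n.+1)%N by rewrite leqW ?leq_addr.
      by split; rewrite leq_max ?(leq_trans h1 Nn) ?(leq_trans h2 Nn).
    by rewrite levf leq_maxl level_act leq_max leqW // leq_addl.
  - move=> b' p' q [h|[s [-> _ _]]] /=; rewrite geq_max => /andP[h1 h2].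
      by apply: (fin_new pE h); rewrite (leq_trans _ h1) // leqW // leq_addr.
    by rewrite ltnn in h2.
(* [D t z]: the triple [t] meets the fresh orbit and is the image of [z.2] under the letter
   [lact z.1 b]. Both this letter and [z.2] are determined by [t], and [lab_edge] dictates the new
   label. *)
pose D t (z : s3 * triple) := (exists i, t i = act z.1 (fresh n)) /\
  forall i, E' (lact z.1 b) (z.2 i) (t i).
have newP b' p' q' : E' b' p' q' -> level q' = n.+1 -> new b' p' q'.
  by move=> [/oldlev[]|].
have Duniq t z z' : D t z -> D t z' -> lact z.1 b = lact z'.1 b /\ z.2 = z'.2.
  move=> [[i ti] h] [_ h'].
  have e : lact z.1 b = lact z'.1 b.
    have [|s [-> _ ]] := newP _ _ _ (h' i); first by rewrite ti levf.
    by rewrite ti !act_fresh => -[->].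
  split=> //; apply/funext => j; apply: (pb_inj pE' (h j)).
  by rewrite e; exact: h'.
pose lam' t := if pselect (exists z, D t z) is left h then
  beta (lact (projT1 (cid h)).1 b) * lam (projT1 (cid h)).2 else lam t.
have lamD t z : D t z -> lam' t = beta (lact z.1 b) * lam z.2.
  move=> Dz; rewrite /lam'; case: pselect => [h|[]]; last by exists z.
  by case: cid => z' /= Dz'; have [-> ->] := Duniq _ _ _ Dz Dz'.
have lamN t : ~ (exists z, D t z) -> lam' t = lam t.
  by rewrite /lam'; case: pselect.
have lamlev t : (forall i, level (t i) <> n.+1) -> lam' t = lam t.
  by move=> h; apply: lamN => -[z [[i ti] _]]; apply: (h i); rewrite ti levf.
have Dinj t z : injective t -> D t z -> injective z.2.
  move=> tI [_ h] i j e; apply: tI; apply: (pb_fun pE' (h i)); rewrite e; exact: h.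
have Dact s t z : D t z -> D (act s \o t) (s3_mul s z.1, act s \o z.2).
  move=> [[i ti] h]; split=> /=; first by exists i; rewrite ti -actM.
  by move=> j; rewrite lactM; exact: (pb_act pE').
have Dpt s t z : D t z -> D (t \o pt_act s) (z.1, z.2 \o pt_act s).
  move=> [[i ti] h]; split=> /= [|j]; last exact: h.
  by exists (pt_act (s3_inv s) i); rewrite pt_actKV.
exists E', lam', (maxn n.+1 b.1.+1); split; last 1 first.
- by exists (fresh n); right; exists s3e; rewrite lact1 !act1.
- split=> //; first by move=> *; left.
    split.
    + move=> s t tI; have [[z Dz]|nD] := pselect (exists z, D t z).
        rewrite (lamD _ _ Dz) (lamD _ _ (Dact s _ _ Dz)) /= (lab_left lE).
          by rewrite !mulgA cb lactM.
        exact: Dinj Dz.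
      rewrite !lamN ?(lab_left lE) // => -[z /(Dact (s3_inv s))].
      by rewrite comp_actK => Dz; apply: nD; eexists; exact: Dz.
    + move=> s t tI; have [[z Dz]|nD] := pselect (exists z, D t z).
        rewrite (lamD _ _ Dz) (lamD _ _ (Dpt s _ _ Dz)) /= (lab_right lE) ?mulgA //.
        exact: Dinj Dz.
      rewrite !lamN ?(lab_right lE) // => -[z /(Dpt (s3_inv s))].
      by rewrite comp_ptK => Dz; apply: nD; eexists; exact: Dz.
    + move=> b' t t' tI t'I h.
      (* No edge starts in the fresh orbit, so [t] keeps its old label and only the label of [t']
         can be new. *)
      rewrite (lamlev t); last by move=> i; exact: srclev (h i).
      have [[i /(newP _ _ _ (h i))[s [e1 e2 e3]]]|nolev] :=
        pselect (exists i, level (t' i) = n.+1).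
        by subst b'; rewrite (lamD t' (s, t)) //; split=> //; exists i.
      have nl i : level (t' i) <> n.+1 by move=> e; apply: nolev; exists i.
      rewrite lamlev //; apply: (lab_edge lE) => // i.
      by case: (h i) => // -[s [_ _ e]]; case: (nl i); rewrite e levf.
    + by rewrite lamlev ?(lab_base lE).
  move=> t; rewrite /lam'; case: pselect => // h; exact: Qb.
- move=> t tN; apply: lamlev => i /nN; by rewrite ltnNge tN.
Qed.

End Labellings.

(** * Words, walks and connected triples *)

Definition signed_letter : Type := (letter * bool)%type.
HB.instance Definition _ := Countable.on signed_letter.

Definition slact (s : s3) (l : signed_letter) : signed_letter := (lact s l.1, l.2).

Definition reducible (l l' : signed_letter) : bool := (l.1 == l'.1) && (l.2 != l'.2).

Definition reduced (w : seq signed_letter) : bool :=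
  sorted (fun l l' => ~~ reducible l l') w.

Definition step (E : edges) (l : signed_letter) (p q : space) : Prop :=
  if l.2 then E l.1 p q else E l.1 q p.

Lemma reduced_slact s w : reduced (map (slact s) w) = reduced w.
Proof.
rewrite /reduced sorted_map; apply: eq_sorted => l l'.
by rewrite /= /reducible /= (can_eq (lactK s)).
Qed.

Lemma reduced_behead l w : reduced (l :: w) -> reduced w.
Proof. exact: path_sorted. Qed.

Section Walks.
Variables (gT : groupType) (iota : s3 -> gT) (beta : letter -> gT).
Hypothesis iota1 : iota s3e = 1.
Hypothesis iotaM : forall s t, iota (s3_mul s t) = iota s * iota t.
Hypothesis beta_compatible : compatible iota beta.

Lemma iotaV s : iota (s3_inv s) = (iota s)^-1.
Proof. by apply: (mulgI (iota s)); rewrite -iotaM s3_mulsV iota1 mulgV. Qed.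

Definition leval (l : signed_letter) : gT := if l.2 then beta l.1 else (beta l.1)^-1.

Definition weval (w : seq signed_letter) : gT := foldr (fun l g => leval l * g) 1 w.

Lemma iota_leval s l : iota s * leval l = leval (slact s l) * iota s.
Proof.
case: l => b [] /=; rewrite /leval /=; first exact: beta_compatible.
exact: compatible_inv.
Qed.

Lemma iota_weval s w : iota s * weval w = weval (map (slact s) w) * iota s.
Proof.
elim: w => [|l w IH] /=; first by rewrite mulg1 mul1g.
by rewrite mulgA iota_leval -mulgA IH mulgA.
Qed.

Section Connected.
Variables (E : edges) (I : Type).

(** The last argument records the group element of the path. The index type is arbitrary: [pt] gives
    triples, and the family [id] indexed by [space] gives the whole action of an element. *)
Inductive conn (t : I -> space) : (I -> space) -> gT -> Prop :=
| conn_refl : conn t t 1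
| conn_step l t' t'' A : conn t t' A -> (forall i, step E l (t' i) (t'' i)) ->
    conn t t'' (leval l * A)
| conn_act s t' A : conn t t' A -> conn t (act s \o t') (iota s * A).

Lemma conn_trans t t' t'' A B : conn t t' A -> conn t' t'' B -> conn t t'' (B * A).
Proof.
move=> c; elim=> [|l t1 t2 B' _ IH h|s t1 B' _ IH]; rewrite ?mul1g // -mulgA.
  exact: conn_step IH h.
exact: conn_act.
Qed.

Lemma conn_step1 l t t' : (forall i, step E l (t i) (t' i)) -> conn t t' (leval l).
Proof. by move=> h; rewrite -[leval l]mulg1; exact: conn_step (conn_refl t) h. Qed.

Lemma conn_act1 s t : conn t (act s \o t) (iota s).
Proof. by rewrite -[iota s]mulg1; exact: conn_act (conn_refl t). Qed.

Lemma conn_sym t t' A : conn t t' A -> conn t' t A^-1.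
Proof.
elim=> [|l t1 t2 B _ IH h|s t1 B _ IH]; first by rewrite invg1; exact: conn_refl.
  rewrite invgM; apply: conn_trans IH.
  have -> : (leval l)^-1 = leval (l.1, ~~ l.2).
    by rewrite /leval /=; case: l.2; rewrite /= ?invgK.
  by apply: conn_step1 => i; move: (h i); rewrite /step /=; case: l.2.
rewrite invgM; apply: conn_trans IH.
by rewrite -iotaV -{2}(comp_actK s t1); exact: conn_act1.
Qed.

Fixpoint walk (w : seq signed_letter) (t t' : I -> space) : Prop :=
  if w is l :: w' then
    exists2 t1, walk w' t t1 & forall i, step E l (t1 i) (t' i)
  else t' = t.

Lemma walk_slact s w t t' : partial_bij E -> walk w t t' ->
  walk (map (slact s) w) (act s \o t) (act s \o t').
Proof.
move=> pE; elim: w t' => [t' ->//|l w IH t' [t1 h1 h2]] /=.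
exists (act s \o t1); first exact: IH.
by move=> i; move: (h2 i); rewrite /step /=; case: l.2 => h; exact: (pb_act pE).
Qed.

(** Compatibility moves all permutations to the start of the path, and a letter undoing the previous
    one is cancelled; the path can then be shortened because edges are partial bijections. *)
Lemma conn_normal_form t t' A : partial_bij E -> conn t t' A ->
  exists w s, [/\ reduced w, A = weval w * iota s & walk w (act s \o t) t'].
Proof.
move=> pE; elim=> [|l t1 t2 B _ [w [s [wr -> h]]] h2|r t1 B _ [w [s [wr -> h]]]].
- by exists [::], s3e; rewrite iota1 mulg1 /= comp_act1.
- have [[l' [w' [ew red]]]|nred] :=
      pselect (exists l' w', w = l' :: w' /\ reducible l l').
    subst w; exists w', s; case: h => t0 h0 h1.
    case: l l' red h1 h2 wr => b e [b' e'] /andP[/= /eqP <- ee'] h1 h2 wr.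
    split; first exact: reduced_behead wr.
      by rewrite /= !mulgA /leval /=; case: e e' ee' {h1 h2 wr} => -[] //= _;
        rewrite ?mulgV ?mulVg mul1g.
    suff -> : t2 = t0 by [].
    apply/funext => i; move: (h1 i) (h2 i); rewrite /step /=.
    case: e e' ee' {h1 h2 wr} => -[] //= _ x y.
      exact: (pb_fun pE) y x.
    exact: (pb_inj pE) y x.
  exists (l :: w), s; split; last by exists t1.
    rewrite /reduced /=; case: w nred wr {h} => //= l' w nred ->; rewrite andbT.
    by apply/negP => red; apply: nred; exists l', w.
  by rewrite /= mulgA.
- exists (map (slact r) w), (s3_mul r s); split.
  + by rewrite reduced_slact.
  + by rewrite mulgA iota_weval iotaM mulgA.
  + by rewrite comp_actM; exact: walk_slact pE h.
Qed.

End Connected.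

Lemma conn_comp E (I J : Type) (f : J -> I) t t' A :
  conn E t t' A -> conn E (t \o f) (t' \o f) A.
Proof.
elim=> [|l t1 t2 B _ IH h|s t1 B _ IH]; first exact: conn_refl.
  by apply: conn_step IH _ => i; exact: h.
exact: (conn_act s IH).
Qed.

Lemma conn_mono (E E' : edges) (I : Type) (t t' : I -> space) A :
  (forall b p q, E b p q -> E' b p q) -> conn E t t' A -> conn E' t t' A.
Proof.
move=> EE'; elim=> [|l t1 t2 B _ IH h|s t1 B _ IH]; first exact: conn_refl.
  by apply: conn_step IH _ => i; move: (h i); rewrite /step; case: l.2 => /EE'.
exact: conn_act.
Qed.

Lemma conn_inj E (I : Type) (t t' : I -> space) A :
  partial_bij E -> conn E t t' A -> injective t -> injective t'.
Proof.
move=> pE c tI; elim: c => [//|l t1 t2 B _ IH h i j e|s t1 B _ IH]; last first.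
  exact: inj_comp (@act_inj s) IH.
apply: IH; move: (h i) (h j); rewrite /step e; case: l.2 => x y.
  exact: (pb_inj pE) x y.
exact: (pb_fun pE) x y.
Qed.

Lemma conn_label E lam (t t' : triple) A :
  partial_bij E -> labelling iota beta E lam ->
  conn E t t' A -> injective t -> lam t' = A * lam t.
Proof.
move=> pE lE c tI; elim: c => [|l t1 t2 B c IH h|s t1 B c IH].
- by rewrite mul1g.
- have t1I := conn_inj pE c tI; have t2I := conn_inj pE (conn_step c h) tI.
  rewrite -mulgA -IH; move: h; rewrite /step /leval; case: l.2 => h.
    exact: (lab_edge lE).
  by rewrite (lab_edge lE _ _ h) ?mulKg.
- by rewrite (lab_left lE) ?IH ?mulgA //; exact: conn_inj pE c tI.
Qed.

(** Injectivity of the homomorphism from F x| S_3 to [gT], in terms of normal forms. *)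
Definition free_letters : Prop := forall w s, reduced w ->
  weval w * iota s = 1 -> w = [::] /\ s = s3e.

Hypothesis free : free_letters.

(** By freeness, the normal form of a path whose group element is a permutation contains no
    letter. *)
Lemma conn_iota E (I : Type) (t t' : I -> space) s :
  partial_bij E -> conn E t t' (iota s) -> t' = act s \o t.
Proof.
move=> pE /(conn_normal_form pE)[w [r [wr e h]]].
have [] := free (w := w) (s := s3_mul r (s3_inv s)) wr.
  by rewrite iotaM iotaV mulgA -e mulgV.
move=> ew er; rewrite ew in h.
by rewrite h -[r]s3_muls1 -(s3_mulVs s) s3_mulA er s3_mul1s.
Qed.

(** A letter of index [N], which has only forced edges so far, is made to send the base triple to
    [u]. Its kind is the one whose stabiliser makes this equivariant. *)
Lemma join_base (Q : gT -> Prop) E lam N (u : triple) :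
  finitary E N -> labelling iota beta E lam ->
  injective u -> lam u = 1 -> ~ (exists A, conn E u base A) ->
  (forall t, Q (lam t)) -> (forall g b, Q g -> Q (g * beta b)) ->
  exists E' lam' N', [/\ (forall b p q, E b p q -> E' b p q),
    finitary E' N', labelling iota beta E' lam',
    forall t, Q (lam' t) & exists A, conn E' u base A].
Proof.
move=> pE lE uI lu1 nub lQ Qb.
(* A permutation fixing the new letter must act on [u] as it does on [base], so [R] has to be the
   stabiliser of this letter. *)
pose R s := u \o pt_act s = act s \o u.
have R1 : R s3e by rewrite /R comp_pt1 comp_act1.
have RM s t : R s -> R t -> R (s3_mul s t).
  by move=> Rs Rt; rewrite /R comp_ptM Rs comp_actM -Rt.
(* If [R] were all of S_3, then [u i] would be fixed by the transposition fixing [i], so [u] would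
   be the base triple. *)
have Rfull : exists s, ~ R s.
  apply: contrapT => /forallNP h; apply: nub; exists 1.
  suff -> : base = u by exact: conn_refl.
  apply/funext => i.
  have [s sN si] : exists2 s, s <> s3e & pt_act s i = i.
    by case: (i); [exists s3t12|exists s3t02|exists s3t01].
  have /funeqP/(_ i) : R s by apply: contrapT; exact: h.
  rewrite /= si => /esym/(act_fix sN)[j -> sj].
  by rewrite (pt_fix_unique sN si sj).
have RN1 s : R s -> R (s3_inv s).
  by rewrite /R => h; rewrite -{1}(comp_actK s u) -{1}h; apply/funext => i /=; rewrite pt_actKV.
have [k Rk] := kind_stabiliser R1 RM Rfull.
pose b : letter := (N, k).
have Rb s : lact s b = b <-> R s.
  by rewrite -Rk /lact /b; split=> [[->]|->].
have Rst s t : lact s b = lact t b -> R (s3_mul (s3_inv s) t).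
  by move=> e; apply/Rb; rewrite lactM -e lactK.
have relab s t i j : lact s b = lact t b -> pt_act s i = pt_act t j ->
    act s (u i) = act t (u j).
  move=> /Rst/funeqP/(_ j) /= + e; rewrite pt_actM -e pt_actK => ->.
  by rewrite actM actKV.
have relab' s t i j : lact s b = lact t b -> act s (u i) = act t (u j) ->
    pt_act s i = pt_act t j.
  move=> /Rst/funeqP/(_ j) /= + e; rewrite actM -e actK pt_actM => /uI <-.
  by rewrite pt_actKV.
pose new b' p q := exists s i, [/\ b' = lact s b, p = act s (base i) & q = act s (u i)].
pose E' b' p q := E b' p q \/ new b' p q.
have newb s i : new (lact s b) (inl i) (act s (u (pt_act (s3_inv s) i))).
  by exists s, (pt_act (s3_inv s) i); rewrite /= pt_actKV.
(* The old edges of the new letter are the forced ones; they agree with the new ones. *)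
have oldnew s p q : E (lact s b) p q -> new (lact s b) p q.
  move=> /(fin_new pE)/(_ (leqnn _))/(forced_act (s3_inv s)); rewrite lactK.
  move=> /forced_fix[r [i [ep eq rN rb ri]]].
  exists s, i; rewrite -[p](actKV s) -[q](actKV s) ep eq; split=> //; congr act.
  have /funeqP/(_ i) : R r by apply/Rb.
  by rewrite /= ri => /esym/(act_fix rN)[j -> rj]; rewrite (pt_fix_unique rN ri rj).
have newfun b' p q q' : new b' p q -> new b' p q' -> q = q'.
  move=> [s [i [-> -> ->]]] [t [j [eb [ep] ->]]]; exact: relab.
have newinj b' p p' q : new b' p q -> new b' p' q -> p = p'.
  move=> [s [i [-> -> ->]]] [t [j [eb -> eq]]] /=; congr inl; exact: relab'.
have E'new s p q : E' (lact s b) p q -> new (lact s b) p q.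
  by move=> [/oldnew|].
pose M := (\max_(i <- [:: p0; p1; p2]) level (u i))%N.
have uM i : (level (u i) <= M)%N.
  by rewrite /M !big_cons big_nil !leq_max; case: i; rewrite leqnn ?orbT.
have pE' : finitary E' (maxn N.+1 M).
  split; first split.
  - move=> b' p q q' [h|[s [i [eb ep eq]]]] [h'|[s' [i' [eb' ep' eq']]]].
    + exact: (pb_fun pE) h h'.
    + by subst b'; apply: (newfun _ _ _ _ (oldnew _ _ _ h)); exists s', i'.
    + by subst b'; apply: (newfun _ _ _ _ _ (oldnew _ _ _ h')); exists s, i.
    + by apply: (newfun b' p); [exists s, i|exists s', i'].
  - move=> b' p p' q [h|[s [i [eb ep eq]]]] [h'|[s' [i' [eb' ep' eq']]]].
    + exact: (pb_inj pE) h h'.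
    + by subst b'; apply: (newinj _ _ _ _ (oldnew _ _ _ h)); exists s', i'.
    + by subst b'; apply: (newinj _ _ _ _ _ (oldnew _ _ _ h')); exists s, i.
    + by apply: (newinj b' _ _ q); [exists s, i|exists s', i'].
  - move=> s b' p q [h|[s' [i [-> -> ->]]]]; first by left; exact: (pb_act pE).
    by right; exists (s3_mul s s'), i; rewrite lactM !actM.
  - by move=> *; left; exact: (fin_forced pE).
  - move=> b' p q [/(fin_level pE)[h1 h2]|[s [i [_ -> ->]]]].
      by rewrite !leq_max !(leqW _) ?h1 ?h2.
    by rewrite /= level_act !leq_max uM orbT.
  - move=> b' p q [h|[s [i [-> _ _]]]]; rewrite geq_max => /andP[h1 _].
      exact: (fin_new pE h (ltnW h1)).
    by rewrite ltnn in h1.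
(* [O s t]: the relabelling of [t] by [s] lies in the component of [u]. There the labels are
   multiplied on the right by a letter, since the new edges demand the label [beta b] for [u]. *)
pose O s t := exists A, conn E u (t \o pt_act s) A.
(* By [lab_right] a path from [u] to its relabelling by [s] has group element [iota s], and freeness
   turns it into the action of [s]. *)
have OR s : O s u -> R s.
  move=> [A c]; have := conn_label pE lE c uI.
  rewrite (lab_right lE) // lu1 mul1g mulg1 => eA.
  by rewrite -eA in c; exact: conn_iota pE c.
have OO s s' t : O s t -> O s' t -> lact s b = lact s' b.
  move=> [A c] [A' c']; have := conn_comp (pt_act (s3_mul (s3_inv s) s')) c.
  rewrite -[X in conn _ _ X]comp_ptM s3_mulKV => /conn_sym c2.
  have c3 := conn_trans c' c2.
  have /OR/Rb : O (s3_mul (s3_inv s) s') u by eexists; exact: c3.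
  by rewrite lactM => e; rewrite -[in LHS]e lactKV.
pose lam' t := if pselect (exists s, O s t) is left h then
  lam t * beta (lact (projT1 (cid h)) b) else lam t.
have lamO s t : O s t -> lam' t = lam t * beta (lact s b).
  move=> Ost; rewrite /lam'; case: pselect => [h|[]]; last by exists s.
  by case: cid => s' /= Os't; rewrite (OO _ _ _ Ost Os't).
have lamN t : ~ (exists s, O s t) -> lam' t = lam t.
  by rewrite /lam'; case: pselect.
have Oact r s t : O s t -> O s (act r \o t).
  by move=> [A c]; exists (iota r * A); exact: conn_act c.
have Opt r s t : O s t -> O (s3_mul (s3_inv r) s) (t \o pt_act r).
  by move=> [A c]; exists A; rewrite -comp_ptM s3_mulKV.
have Ostep l s t t' : O s t -> (forall i, step E l (t i) (t' i)) -> O s t'.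
  by move=> [A c] h; exists (leval l * A); apply: conn_step c _ => i; exact: h.
have Obase s r : ~ O s (act r \o base).
  move=> /(Oact (s3_inv (s3_mul r s))); rewrite -base_act => -[A].
  have -> : (act (s3_inv (s3_mul r s)) \o (base \o pt_act r)) \o pt_act s = base.
    by rewrite -compA -comp_ptM base_act comp_actK.
  by move=> c; apply: nub; exists A.
have Ou : O s3e u by exists 1; rewrite comp_pt1; exact: conn_refl.
exists E', lam', (maxn N.+1 M); split=> //.
- by move=> *; left.
- split.
  + move=> r t tI; have [[s Ost]|nO] := pselect (exists s, O s t).
      by rewrite (lamO _ _ Ost) (lamO _ _ (Oact r _ _ Ost)) (lab_left lE) ?mulgA.
    rewrite !lamN ?(lab_left lE) // => -[s /(Oact (s3_inv r))].
    by rewrite comp_actK => Ost; apply: nO; exists s.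
  + move=> r t tI; have [[s Ost]|nO] := pselect (exists s, O s t).
      rewrite (lamO _ _ Ost) (lamO _ _ (Opt r _ _ Ost)) (lab_right lE) //.
      by rewrite -!mulgA beta_compatible -lactM s3_mulKV.
    rewrite !lamN ?(lab_right lE) // => -[s /(Opt (s3_inv r))].
    by rewrite comp_ptK => Ost; apply: nO; eexists; exact: Ost.
  + move=> b' t t' tI t'I h.
    have [[s eb]|nb] := pselect (exists s, b' = lact s b); last first.
      have hE i : E b' (t i) (t' i).
        by case: (h i) => // -[s [j [e _ _]]]; case: nb; exists s.
      have [[s Ost]|nO] := pselect (exists s, O s t).
        rewrite (lamO _ _ Ost) (lamO _ _ (Ostep (b', true) _ _ _ Ost hE)).
        by rewrite (lab_edge lE tI t'I hE) mulgA.
      rewrite !lamN // ?(lab_edge lE tI t'I hE) // => -[s Ost].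
      by apply: nO; exists s; exact: (Ostep (b', false) _ _ _ Ost hE).
    (* Edges of the new letters start in [pt], so [t] is a permuted base triple, outside the
       component of [u], and [t'] is a moved and relabelled copy of [u]. *)
    subst b'; have {}h i := E'new _ _ _ (h i).
    have tinl i : exists j, t i = inl j by have [s' [j [_ -> _]]] := h i; exists (pt_act s' j).
    have [f ft] := choice tinl.
    have [|r fr] := pt_injP (f := f); first by move=> i j e; apply: tI; rewrite !ft e.
    pose q := s3_mul (s3_inv s) r.
    have et : t = act r \o base by apply/funext => i; rewrite ft fr.
    have et' : t' = (act s \o u) \o pt_act q.
      apply/funext => i; apply: (newfun _ _ _ _ (h i)); rewrite et.
      by exists s, (pt_act q i); split=> //=; rewrite -pt_actM /q s3_mulKV.
    have Ot' : O (s3_inv q) t'.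
      by rewrite et'; have := Opt q _ _ (Oact s _ _ Ou); rewrite s3_muls1.
    rewrite (lamO _ _ Ot') lamN; last first.
      by move=> [s']; rewrite et; exact: Obase.
    rewrite et et' (lab_right lE) ?(lab_left lE) ?lu1 ?(lab_base lE) ?mulg1 //.
      by rewrite -mulgA beta_compatible lactKV mulgA beta_compatible -mulgA -iotaM s3_mulKV.
    - by move=> i j [].
    - exact: act_comp_inj.
  + rewrite lamN ?(lab_base lE) // => -[s]; rewrite -(comp_act1 base); exact: Obase.
- by move=> t; rewrite /lam'; case: pselect => // h; exact: Qb.
- exists (leval (b, false)); apply: conn_step1 => i; right.
  by exists s3e, i; rewrite lact1 !act1.
Qed.
End Walks.

(** * The limit action *)

Lemma base_inj : injective base. Proof. by move=> i j []. Qed.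

Lemma finitary_mono E N N' : (N <= N')%N -> finitary E N -> finitary E N'.
Proof.
move=> NN [h1 h2 h3 h4]; split=> // [b p q /h3[hp hq]|b p q /h4 h /(leq_trans NN)//].
by rewrite !(leq_trans _ NN).
Qed.

Lemma finitary_forced : finitary forced 0.
Proof.
split; first split=> //.
- by move=> b p q q' [<- _] [<- _].
- by move=> b p p' q [-> _] [-> _].
- exact: forced_act.
- by [].
- by move=> b p q /forced_fix[r [i [-> -> _ _ _]]].
- by [].
Qed.

(** A letter of kind [Kpt j] has its only forced edge at [j], and the other letters have none. This
    makes [lab_edge] vacuous at the start of the construction. *)
Lemma forced_triple b (t t' : triple) : injective t -> (forall i, forced b (t i) (t' i)) -> False.
Proof.
move=> tI h; suff [j hj] : exists j, forall i, t i = inl j.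
  by have := tI p0 p1; rewrite !hj => /(_ erefl).
case: b h => n k h; case: k h => [e|j|s] h; [exists p0|exists j|exists p0] => i;
  have [r [x [-> _ rN [rk] rx]]] := forced_fix (h i).
- by case: r rN rk rx {h} => //= _; case: e => //; case: x.
- by rewrite (pt_fix_unique rN rx rk).
- by case: r s rN rk {h rx} => -[].
Qed.

Section Construction.
Variables (gT : groupType) (iota : s3 -> gT) (beta : letter -> gT).
Hypothesis iota1 : iota s3e = 1.
Hypothesis iotaM : forall s t, iota (s3_mul s t) = iota s * iota t.
Hypothesis beta_compatible : compatible iota beta.
Hypothesis free : free_letters iota beta.

(** By [s3_inner], each orbit of injective triples under action and relabelling has a representative
    on which acting by [s] equals relabelling by [r] only if [s = r]. Then the product [s r] is a
    well-defined label for the triple obtained by acting by [s] and relabelling by [r]. *)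
Lemma labelling_forced : exists2 lam, labelling iota beta forced lam &
  forall t, exists s, lam t = iota s.
Proof.
pose orb (t t0 : triple) := exists s r, t = act s \o (t0 \o pt_act r).
pose nice (t0 : triple) := forall s r, act s \o t0 = t0 \o pt_act r -> s = r.
pose P t t0 := orb t t0 /\ nice t0.
have Pex t : injective t -> exists t0, P t t0.
  move=> tI; pose C s r := act s \o t = t \o pt_act r.
  have [|||q hq] := s3_inner (C := C).
  - move=> s r s' r' h h'; rewrite /C comp_actM h' comp_ptM -h.
    by apply/funext => i /=; have /funeqP/(_ (pt_act r' i)) /= := h.
  - move=> s r r' h; rewrite /C h => /funeqP e.
    rewrite -[r']s3_mul1s -(s3_mulsV r) -s3_mulA.
    rewrite (pt_act_faithful (s := s3_mul (s3_inv r) r')) ?s3_muls1 // => i.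
    by rewrite pt_actM -(tI _ _ (e i)) pt_actK.
  - move=> s s' r h h'; have e : act (s3_mul (s3_inv s) s') \o t = t.
      by rewrite comp_actM h' -h comp_actK.
    by have := act_triple_fix tI e => e'; rewrite -[s]s3_muls1 -e' s3_mulKV.
  exists (t \o pt_act q); split.
    by exists s3e, (s3_inv q); rewrite comp_ptK comp_act1.
  move=> s r h; have : C s (s3_mul q (s3_mul r (s3_inv q))).
    rewrite /C !comp_ptM -h; apply/funext => i /=.
    by rewrite pt_actKV.
  by move=> /hq; rewrite -!s3_mulA s3_mulVs s3_muls1 => /(congr1 (s3_mul (s3_inv q)));
    rewrite !s3_mulVK.
pose rep t := if pselect (exists t0, P t t0) is left h then projT1 (cid h) else base.
have repP t : injective t -> P t (rep t).
  by move=> tI; rewrite /rep; case: pselect => [h|/(_ (Pex _ tI))//]; case: cid.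
(* The choice depends on the triple only through the predicate [P t], which is constant on
   orbits. *)
have rep_eq t t' : orb t t' -> orb t' t -> rep t = rep t'.
  move=> o o'; suff e : P t = P t' by rewrite /rep e.
  have tr x y z : orb x y -> orb y z -> orb x z.
    move=> [s [r ->]] [s' [r' ->]]; exists (s3_mul s s'), (s3_mul r' r).
    by rewrite comp_actM comp_ptM.
  by apply/funext => t0; apply/propext; split=> -[h1 h2]; split=> //; exact: tr h1.
pose lam0 t := if pselect (exists x : s3 * s3, t = act x.1 \o (rep t \o pt_act x.2))
  is left h then iota (s3_mul (projT1 (cid h)).1 (projT1 (cid h)).2) else 1.
have lam0E t s r : injective t -> t = act s \o (rep t \o pt_act r) ->
    lam0 t = iota (s3_mul s r).
  move=> tI e; rewrite /lam0; case: pselect => [h|[]]; last by exists (s, r).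
  case: cid => -[s' r'] /= e'; congr iota.
  have : act (s3_mul (s3_inv s) s') \o rep t = rep t \o pt_act (s3_mul r (s3_inv r')).
    apply/funext => i; rewrite /= actM pt_actM.
    have /funeqP/(_ (pt_act (s3_inv r') i)) /= := etrans (esym e) e'.
    by rewrite pt_actKV => /(congr1 (act (s3_inv s))); rewrite actK.
  have [_ rnice] := repP _ tI => /rnice/(congr1 (fun x => s3_mul (s3_mul s x) r')).
  by rewrite s3_mulKV -!s3_mulA s3_mulVs s3_muls1.
have lam0_act t s r : injective t ->
    lam0 (act s \o (t \o pt_act r)) = iota s * lam0 t * iota r.
  move=> tI; have [[s0 [r0 e]] _] := repP _ tI.
  rewrite (lam0E t s0 r0) // -!iotaM -(s3_mulA s) -(s3_mulA s0) s3_mulA.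
  apply: lam0E; first exact: act_comp_inj (pt_comp_inj tI).
  rewrite (rep_eq _ t); first by rewrite {1}e comp_actM comp_ptM.
    by exists s, r.
  exists (s3_inv s), (s3_inv r); apply/funext => i /=.
  by rewrite pt_actKV actK.
exists lam0; last first.
  by move=> t; rewrite /lam0; case: pselect => [h|_]; [eexists|exists s3e].
split.
- move=> s t tI; have := lam0_act t s s3e tI.
  by rewrite comp_pt1 iota1 mulg1.
- move=> s t tI; have := lam0_act t s3e s tI.
  by rewrite comp_act1 iota1 mul1g.
- by move=> b t t' tI _ /(forced_triple tI).
- have [[s [r e]] nb] := repP _ base_inj.
  have e' : rep base = base \o pt_act (s3_mul (s3_inv s) (s3_inv r)).
    apply/funext => i; have /funeqP/(_ (pt_act (s3_inv r) i)) /= := e.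
    by rewrite pt_actKV => /(congr1 (act (s3_inv s))); rewrite actK pt_actM => <-.
  set q := s3_mul _ _ in e'.
  rewrite (lam0E base s r base_inj e) -iota1; congr iota.
  (* Niceness of the representative [base \o pt_act q] makes [q] central in S_3, hence trivial. *)
  have qc x : s3_mul q x = s3_mul x q.
    suff h : s3_mul q (s3_mul x (s3_inv q)) = x by rewrite -{2}h -!s3_mulA s3_mulVs s3_muls1.
    apply: nb; apply/funext => i; rewrite e' /= -!pt_actM.
    by rewrite -!s3_mulA s3_mulVs s3_muls1.
  have q1 : q = s3e by move: (qc s3t01) (qc s3t12); case: (q).
  by move: q1; rewrite /q; case: (s) (r) => -[].
Qed.

Lemma weval_cat w w' : weval beta (w ++ w') = weval beta w * weval beta w'.
Proof. by elim: w => [|l w IH]; rewrite /= ?mul1g // IH mulgA. Qed.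

(** The parity of the S_3-component of an element of F x| S_3; freeness makes it unique. *)
Definition has_sign (b : bool) (g : gT) : Prop :=
  exists w s, g = weval beta w * iota s /\ s3_odd s = b.

Definition generated (g : gT) : Prop := exists b, has_sign b g.

Lemma has_sign_iota s : has_sign (s3_odd s) (iota s).
Proof. by exists [::], s; rewrite mul1g. Qed.

Lemma has_sign_leval l : has_sign false (leval beta l).
Proof. by exists [:: l], s3e; rewrite iota1 /= !mulg1. Qed.

Lemma has_signM b c g h : has_sign b g -> has_sign c h -> has_sign (b (+) c) (g * h).
Proof.
move=> [w [s [-> <-]]] [w' [s' [-> <-]]].
exists (w ++ map (slact s) w'), (s3_mul s s'); rewrite s3_oddM; split=> //.
rewrite weval_cat iotaM -!mulgA; congr (_ * _).
by rewrite !mulgA iota_weval.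
Qed.

Lemma leval_inv l : (leval beta l)^-1 = leval beta (l.1, ~~ l.2).
Proof. by case: l => b []; rewrite /leval /= ?invgK. Qed.

Lemma has_signV b g : has_sign b g -> has_sign b g^-1.
Proof.
move=> [w [s [-> <-]]]; rewrite invgM -iotaV //.
have -> : s3_odd s = s3_odd (s3_inv s) (+) false by case: s.
apply: has_signM; first exact: has_sign_iota.
elim: w => [|l w IH] /=; first by rewrite invg1 -iota1; exact: has_sign_iota.
by rewrite invgM -[false]addbF; apply: has_signM => //; rewrite leval_inv; exact: has_sign_leval.
Qed.

Lemma generated_iota s : generated (iota s).
Proof. by eexists; exact: has_sign_iota. Qed.

Lemma generated_leval l : generated (leval beta l).
Proof. by eexists; exact: has_sign_leval. Qed.

Lemma generatedM g h : generated g -> generated h -> generated (g * h).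
Proof. by move=> [b hb] [c hc]; eexists; exact: has_signM hb hc. Qed.

Lemma generatedV g : generated g -> generated g^-1.
Proof. by move=> [b hb]; exists b; exact: has_signV. Qed.

Lemma reduce_word w : exists2 w', reduced w' & weval beta w' = weval beta w.
Proof.
elim: w => [|l w [w' rw' e]]; first by exists [::].
have [[l' [w'' [ew red]]]|nred] := pselect (exists l' w'', w' = l' :: w'' /\ reducible l l').
  subst w'; exists w''; first exact: reduced_behead rw'.
  rewrite /= -e /=; suff -> : leval beta l' = (leval beta l)^-1 by rewrite mulVKg.
  rewrite leval_inv; move: red; case: l' {e rw'} => b' e'; case: l => b e.
  by move=> /andP[/= /eqP <-]; case: e; case: e'.
exists (l :: w'); last by rewrite /= e.
rewrite /reduced /=; case: w' nred rw' {e} => //= l' w' nred rw'; apply/andP; split=> //.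
by apply/negP => red; apply: nred; exists l', w'.
Qed.

Lemma has_sign_uniq b c g : has_sign b g -> has_sign c g -> b = c.
Proof.
move=> hb /has_signV hc; have [w [s []]] := has_signM hb hc.
have [w' rw' <-] := reduce_word w; rewrite mulgV => /esym/(free rw')[_ ->].
by case: b c {hb hc} => -[].
Qed.

(** Labels stay in the generated subgroup so that they can be written as words, on which
    [connect_base] inducts. *)
Record stage (E : edges) (lam : triple -> gT) (N : nat) : Prop := Stage {
  stage_finitary : finitary E N;
  stage_labelling : labelling iota beta E lam;
  stage_generated : forall t, generated (lam t) }.

Lemma stage_mono E lam N N' : (N <= N')%N -> stage E lam N -> stage E lam N'.
Proof. by move=> NN [h1 h2 h3]; split=> //; exact: finitary_mono h1. Qed.

Lemma extend_step E lam N l p : stage E lam N ->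
  exists E' lam' N', [/\ forall b p q, E b p q -> E' b p q, stage E' lam' N',
    forall t : triple, (forall i, level (t i) <= N)%N -> lam' t = lam t
  & exists q, step E' l p q].
Proof.
move=> [fE lE gE]; case: l => b [].
  have [|E' [lam' [N' [[EE' fE' lE' gE'] lev bp]]]] :=
      extend_forward (b := b) p beta_compatible fE lE gE.
    by move=> s g; apply: generatedM; exact: (generated_leval (_, true)).
  by exists E', lam', N'.
(* A backward edge is a forward edge of the reversed relation, with all letters replaced by their
   inverses. *)
have [|E' [lam' [N' [[EE' fE' lE' gE'] lev bp]]]] := extend_forward (b := b) p
    (compatible_inv beta_compatible) (finitary_op fE) (labelling_op lE) gE.
  by move=> s g; apply: generatedM; exact: (generated_leval (_, false)).
exists (edges_op E'), lam', N'; split=> //; first by move=> ? ? ?; exact: EE'.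
split=> //; first exact: finitary_op.
have := labelling_op lE'; congr labelling; apply/funext => b' /=.
by rewrite invgK.
Qed.

Lemma extend_triple E lam N l (u : triple) : stage E lam N ->
  exists E' lam' N' u', [/\ forall b p q, E b p q -> E' b p q, stage E' lam' N',
    lam' u = lam u & forall i, step E' l (u i) (u' i)].
Proof.
(* Raising the bounds above the levels of [u] preserves the label of [u] through the three
   extensions. *)
move=> st0; pose M := (\max_(i <- [:: p0; p1; p2]) level (u i))%N.
have uM N' i : (level (u i) <= maxn N' M)%N.
  by rewrite /M !big_cons big_nil !leq_max; case: i; rewrite leqnn ?orbT.
have stM F lam' N' : stage F lam' N' -> stage F lam' (maxn N' M).
  by apply: stage_mono; rewrite leq_maxl.
have [E0 [lam0 [N0 [E01 st1 lev0 [q0 h0]]]]] := extend_step l (u p0) (stM _ _ _ st0).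
have [E1 [lam1 [N1 [E12 st2 lev1 [q1 h1]]]]] := extend_step l (u p1) (stM _ _ _ st1).
have [E2 [lam2 [N2 [E23 st3 lev2 [q2 h2]]]]] := extend_step l (u p2) (stM _ _ _ st2).
exists E2, lam2, N2, (fun i => match i with p0 => q0 | p1 => q1 | p2 => q2 end).
split=> //; first by move=> b p q /E01/E12/E23.
  by rewrite lev2 ?lev1 ?lev0.
case=> //; first by move: h0; rewrite /step; case: l.2 => /E12/E23.
by move: h1; rewrite /step; case: l.2 => /E23.
Qed.

(** Write the label of [u] as a word. Moving [u] along the inverse of its first letter shortens the
    word; once only a permutation is left, acting by its inverse gives the label 1 required by
    [join_base]. *)
Lemma connect_base E lam N (u : triple) : stage E lam N -> injective u ->
  exists E' lam' N', [/\ forall b p q, E b p q -> E' b p q, stage E' lam' N' &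
    exists A, conn iota beta E' u base A].
Proof.
move=> st uI; have [_ [w [s [+ _]]]] := stage_generated st u.
elim: w E lam N u st uI => [|l w IH] E lam N u st uI.
  rewrite /= mul1g => lu; pose u' := act (s3_inv s) \o u.
  have u'I : injective u' by exact: act_comp_inj.
  have cu F : conn iota beta F u u' (iota (s3_inv s)) by exact: conn_act1.
  case: st => fE lE gE.
  have lu' : lam u' = 1 by rewrite (lab_left lE) // lu -iotaM s3_mulVs.
  have [[A c]|nb] := pselect (exists A, conn iota beta E u' base A).
    by exists E, lam, N; split=> //; exists (A * iota (s3_inv s)); exact: conn_trans c.
  have [|E' [lam' [N' [EE' fE' lE' gE' [A c]]]]] :=
      join_base iota1 iotaM beta_compatible free fE lE u'I lu' nb (Q := generated) gE.
    by move=> g b /generatedM; apply; exact: (generated_leval (b, true)).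
  exists E', lam', N'; split=> //; exists (A * iota (s3_inv s)); exact: conn_trans c.
move=> lu; have [E1 [lam1 [N1 [u1 [EE1 st1 lu1 h1]]]]] := extend_triple (l.1, ~~ l.2) u st.
have c1 : conn iota beta E1 u u1 (leval beta (l.1, ~~ l.2)) by exact: conn_step1.
have u1I := conn_inj (stage_finitary st1) c1 uI.
have lu2 : lam1 u1 = weval beta w * iota s.
  rewrite (conn_label (stage_finitary st1) (stage_labelling st1) c1 uI) lu1 lu /=.
  by rewrite !mulgA /leval /=; case: l.2; rewrite /= ?mulVg ?mulgV mul1g.
have [E' [lam' [N' [EE' st' [A c]]]]] := IH _ _ _ _ st1 u1I lu2.
exists E', lam', N'; split=> //; first by move=> b p q /EE1/EE'.
by eexists; exact: conn_trans (conn_mono EE' c1) c.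
Qed.

(** The requirements on the limit: a signed letter must be defined at a point, or a triple must be
    connected to the base. Triples are coded as tuples to keep the tasks countable. *)
Definition task : Type := (signed_letter * space + space * space * space)%type.

Definition triple_of (x : space * space * space) : triple :=
  fun i => match i with p0 => x.1.1 | p1 => x.1.2 | p2 => x.2 end.

Definition fulfilled (E : edges) (x : task) : Prop :=
  match x with
  | inl (l, p) => exists q, step E l p q
  | inr y => injective (triple_of y) -> exists A, conn iota beta E (triple_of y) base A
  end.

Lemma fulfilled_mono (E E' : edges) x :
  (forall b p q, E b p q -> E' b p q) -> fulfilled E x -> fulfilled E' x.
Proof.
move=> EE'; case: x => [[l p] [q h]|y h /h[A c]] /=; last by exists A; exact: conn_mono c.
by exists q; move: h; rewrite /step; case: l.2 => /EE'.
Qed.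

Definition good (E : edges) : Prop := exists lam N, stage E lam N.

Lemma fulfill E x : good E -> exists E',
  [/\ good E', forall b p q, E b p q -> E' b p q & fulfilled E' x].
Proof.
move=> [lam [N st]]; case: x => [[l p]|y].
  have [E' [lam' [N' [h1 h2 _ h3]]]] := extend_step l p st.
  by exists E'; split=> //; exists lam', N'.
have [inj|ninj] := pselect (injective (triple_of y)).
  have [E' [lam' [N' [h1 h2 h3]]]] := connect_base st inj.
  by exists E'; split=> //; exists lam', N'.
by exists E; split=> //; exists lam, N.
Qed.

Lemma limit_edges : exists E : edges, [/\ partial_bij E,
  forall l p, exists q, step E l p q,
  forall u : triple, injective u -> exists A, conn iota beta E u base A
  & forall (u : triple) A, injective u -> conn iota beta E u u A -> A = 1].
Proof.
have good0 : good forced.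
  have [lam lE lg] := labelling_forced; exists lam, 0%N; split=> //.
    exact: finitary_forced.
  by move=> t; have [s ->] := lg t; exact: generated_iota.
have next (x : {E | good E} * task) : {E' : {E | good E} |
    (forall b p q, sval x.1 b p q -> sval E' b p q) /\ fulfilled (sval E') x.2}.
  apply: cid; have [E' [g h1 h2]] := fulfill x.2 (svalP x.1).
  by exists (exist _ E' g).
(* Stage [m.+1] fulfils the task with code [m]; a number coding no task changes nothing. *)
pose seqE := fix seqE n : {E | good E} := if n is m.+1 then
  (if unpickle m is Some x then sval (next (seqE m, x)) else seqE m)
  else exist _ _ good0.
have seqS n b p q : sval (seqE n) b p q -> sval (seqE n.+1) b p q.
  by rewrite /=; case: unpickle => // x; case: (next _) => E' /= [h _]; exact: h.
have seq_mono m n b p q : (m <= n)%N -> sval (seqE m) b p q -> sval (seqE n) b p q.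
  move=> /subnK <-; elim: (n - m)%N => // k IH /IH; exact: seqS.
pose E b p q := exists n, sval (seqE n) b p q.
have toE n b p q : sval (seqE n) b p q -> E b p q by exists n.
have goodn n : exists lam N, stage (sval (seqE n)) lam N by exact: (svalP (seqE n)).
have done x : fulfilled E x.
  apply: (@fulfilled_mono (sval (seqE (pickle x).+1))) => //; first exact: toE.
  by rewrite /= pickleK; case: (next _) => E' [].
have two b p q b' p' q' : E b p q -> E b' p' q' -> exists n,
    sval (seqE n) b p q /\ sval (seqE n) b' p' q'.
  by move=> [m h] [n h']; exists (maxn m n); split; [move: h|move: h'];
    apply: seq_mono; rewrite ?leq_maxl ?leq_maxr.
have pE : partial_bij E.
  split.
  - move=> b p q q' h h'; have [n [{}h {}h']] := two _ _ _ _ _ _ h h'.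
    have [lam [N [fE _ _]]] := goodn n; exact: (pb_fun fE) h h'.
  - move=> b p p' q h h'; have [n [{}h {}h']] := two _ _ _ _ _ _ h h'.
    have [lam [N [fE _ _]]] := goodn n; exact: (pb_inj fE) h h'.
  - move=> s b p q [n h]; exists n.
    have [lam [N [fE _ _]]] := goodn n; exact: (pb_act fE).
exists E; split=> //.
- by move=> l p; have := done (inl (l, p)).
- move=> u uI; pose y := (u p0, u p1, u p2).
  have e : triple_of y = u by apply/funext; case.
  by have := done (inr y); rewrite /= e; apply.
- move=> u A uI c.
  (* A path of triples uses finitely many edges, so it lives in one stage, where the labelling shows
     that its group element is 1. *)
  suff aux t B : conn iota beta E u t B -> exists n, conn iota beta (sval (seqE n)) u t B.
    have [n cn] := aux _ _ c; have [lam [N [fE lE _]]] := goodn n.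
    have := conn_label fE lE cn uI => h.
    by apply: (mulIg (lam u)); rewrite mul1g -h.
  elim=> [|l t1 t2 C _ [n cn] h|s t1 C _ [n cn]].
  + by exists 0%N; exact: conn_refl.
  + have ex i : exists m, step (sval (seqE m)) l (t1 i) (t2 i).
      by move: (h i); rewrite /step; case: l.2.
    have [m hm] := choice ex; pose M := maxn n (maxn (m p0) (maxn (m p1) (m p2))).
    exists M; apply: conn_step.
      by apply: conn_mono cn => b p q; apply: seq_mono; rewrite leq_maxl.
    move=> i; have mM : (m i <= M)%N by rewrite !leq_max; case: i; rewrite leqnn ?orbT.
    by move: (hm i); rewrite /step; case: l.2; exact: seq_mono.
  + by exists n; exact: conn_act.
Qed.

End Construction.

(** * The sharply 3-transitive action on the limit and its point stabilisers *)

Local Open Scope classical_set_scope.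

Definition ord_of_pt (i : pt) : 'I_3 :=
  match i with p0 => @Ordinal 3 0 isT | p1 => @Ordinal 3 1 isT | p2 => @Ordinal 3 2 isT end.
Definition pt_of_ord (i : 'I_3) : pt :=
  match val i with 0%N => p0 | 1%N => p1 | _ => p2 end.
Lemma ord_of_ptK : cancel ord_of_pt pt_of_ord. Proof. by case. Qed.
Lemma pt_of_ordK : cancel pt_of_ord ord_of_pt.
Proof. by case=> -[|[|[|//]]] h; apply: val_inj. Qed.

Lemma triple_of_inj a b c : a <> b -> b <> c -> a <> c -> injective (triple_of (a, b, c)).
Proof. by move=> ab bc ac [] [] // ; rewrite /triple_of /= => e; congruence. Qed.

Section Action.
Variables (gT : groupType) (iota : s3 -> gT) (beta : letter -> gT).
Hypothesis iota1 : iota s3e = 1.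
Hypothesis iotaM : forall s t, iota (s3_mul s t) = iota s * iota t.
Hypothesis beta_compatible : compatible iota beta.
Hypothesis free : free_letters iota beta.

Theorem nonsplit_of_free : exists G : set gT, subgroup G /\ nonsplit_sharply3_transitive G.
Proof.
have [E [pE total trans fixed]] := limit_edges iota1 iotaM beta_compatible free.
pose cn := fun I : Type => @conn gT iota beta E I.
pose G : set gT := [set g | generated iota beta g].
have conn_gen I (t t' : I -> space) g : cn I t t' g -> G g.
  elim=> [|l t1 t2 A _ IH _|s t1 A _ IH].
  - by rewrite -iota1; exact: generated_iota.
  - by apply: generatedM => //; exact: generated_leval.
  - by apply: generatedM => //; exact: generated_iota.
have conn_uniq I (t t' t'' : I -> space) g : cn I t t' g -> cn I t t'' g -> t' = t''.
  move=> c c'; have := conn_trans (conn_sym iota1 iotaM c) c'.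
  rewrite mulgV -iota1 => /(conn_iota iota1 iotaM beta_compatible free pE).
  by rewrite comp_act1.
(* Letters are total in the limit, so an element can be applied to the whole space at once by
   following the family [id]. *)
have ex g : exists phi : space -> space, G g -> cn _ id phi g.
  have [[b [w [s [-> _]]]]|nG] := pselect (G g); last by exists id.
  suff [phi c] : exists phi, cn _ id phi (weval beta w * iota s) by exists phi.
  elim: w => [|l w [phi c]].
    by exists (act s \o id); rewrite mul1g; exact: conn_act1.
  have [psi h] := choice (fun p => total l (phi p)).
  by exists psi; rewrite /= -mulgA; exact: conn_step c h.
have [al alP] := choice ex.
have al_conn I (t : I -> space) g : G g -> cn I t (al g \o t) g.
  by move=> Gg; exact: (conn_comp t (alP g Gg)).
have alE I (t t' : I -> space) g : cn I t t' g -> al g \o t = t'.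
  move=> c; exact: conn_uniq (al_conn _ t _ (conn_gen _ _ _ _ c)) c.
have Gsub : subgroup G.
  split; first by rewrite /G /= -iota1; exact: generated_iota.
    by move=> g h; exact: generatedM.
  by move=> g; exact: generatedV.
have [G1 GM GV] := Gsub.
have al1 p : al 1 p = p.
  by have /funeqP/(_ p) := alE _ id _ _ (conn_refl _ _ _ _).
have alM g h p : G g -> G h -> al (g * h) p = al g (al h p).
  move=> Gg Gh; have := conn_trans (al_conn _ id _ Gh) (al_conn _ (al h \o id) _ Gg).
  by move=> /alE/funeqP/(_ p).
have ali s : al (iota s) = act s.
  by have := alE _ id _ _ (conn_act1 _ _ _ _ _); exact.
have alKV g p : G g -> al g^-1 (al g p) = p.
  by move=> Gg; rewrite -alM ?mulVg ?al1 //; exact: GV.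
have alVK g p : G g -> al g (al g^-1 p) = p.
  by move=> Gg; rewrite -alM ?mulgV ?al1 //; exact: GV.
have al_inj g : G g -> injective (al g).
  by move=> Gg p q /(congr1 (al g^-1)); rewrite !alKV.
have faith (u : triple) g : injective u -> G g -> al g \o u = u -> g = 1.
  move=> uI Gg e; have := al_conn _ u g Gg; rewrite e; exact: fixed.
have tr3 (u v : triple) : injective u -> injective v -> exists g, G g /\ al g \o u = v.
  move=> /trans[A cA] /trans[B cB].
  have c := conn_trans cA (conn_sym iota1 iotaM cB).
  by exists (B^-1 * A); split; [exact: conn_gen c|exact: alE c].
have faith3 a b c g : G g -> a <> b -> b <> c -> a <> c ->
    al g a = a -> al g b = b -> al g c = c -> g = 1.
  move=> Gg ab bc ac ea eb ec; apply: (faith _ _ (triple_of_inj ab bc ac)) => //.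
  by apply/funext; case.
have tr33 a b c a' b' c' : a <> b -> b <> c -> a <> c ->
    a' <> b' -> b' <> c' -> a' <> c' ->
    exists g, [/\ G g, al g a = a', al g b = b' & al g c = c'].
  move=> ab bc ac ab' bc' ac'.
  have [g [Gg /funeqP e]] := tr3 _ _ (triple_of_inj ab bc ac) (triple_of_inj ab' bc' ac').
  by exists g; split=> //; [exact: (e p0)|exact: (e p1)|exact: (e p2)].
(* An element swapping two points and fixing a third one is conjugate to a
   transposition of the base triple. *)
have swap a b x g : G g -> a <> b -> b <> x -> a <> x ->
    al g a = b -> al g b = a -> al g x = x ->
    has_sign iota beta true g /\ forall y, al g y = y -> y = x.
  move=> Gg ab bx ax ga gb gx; pose v := triple_of (a, b, x).
  have [k [Gk /funeqP kb]] := tr3 _ v base_inj (triple_of_inj ab bx ax).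
  have Gk' := GV _ Gk.
  pose g' := iota s3t01 * (k^-1 * g * k).
  have Gg' : G (k^-1 * g * k) by apply: (GM) => //; exact: GM.
  have e1 : g' = 1.
    apply: (faith _ _ base_inj).
      by apply: (GM) => //; exact: generated_iota.
    have kk i : al k^-1 (v i) = base i by rewrite -kb /= alKV.
    apply/funext => i /=; rewrite alM //; last exact: generated_iota.
    rewrite alM //; last exact: GM.
    rewrite alM // ali; have /= -> := kb i.
    case: i; rewrite /v /= ?ga ?gb ?gx.
    - by rewrite (kk p1).
    - by rewrite (kk p0).
    - by rewrite (kk p2).
  have eg : k^-1 * g * k = iota s3t01.
    by apply: (mulgI (iota s3t01)); rewrite -/g' e1 -iotaM /= iota1.
  split.
    have [b0 hk] := Gk.
    have -> : g = k * iota s3t01 * k^-1.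
      by rewrite -eg !mulgA mulgV mul1g mulgK.
    have := has_signM iotaM beta_compatible
      (has_signM iotaM beta_compatible hk (has_sign_iota _ _ s3t01)).
    move=> /(_ _ _ (has_signV iota1 iotaM beta_compatible hk)).
    by case: (b0).
  move=> y gy; have : act s3t01 (al k^-1 y) = al k^-1 y.
    by rewrite -ali -eg !alM // ?alVK ?gy //; exact: GM.
  move=> /act_fix[//|j ej]; case: j ej => // ej _.
  by rewrite -(alVK k y Gk) ej; exact: (kb p2).
exists G; split=> //; exists space, al; split.
  split; first by split=> //.
    exists (fun i => inl (pt_of_ord i)) => i j [e].
    exact: (can_inj pt_of_ordK).
  move=> s t sI tI.
  have sI' : injective (s \o ord_of_pt) by apply: inj_comp => //; exact: can_inj ord_of_ptK.
  have tI' : injective (t \o ord_of_pt) by apply: inj_comp => //; exact: can_inj ord_of_ptK.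
  have [g [Gg e]] := tr3 _ _ sI' tI'.
  have ge i : al g (s i) = t i.
    by have /funeqP/(_ (pt_of_ord i)) /= := e; rewrite pt_of_ordK.
  exists g; split=> [//|h [Gh he]].
  have e1 : g^-1 * h = 1.
    apply: (faith _ _ sI'); first by apply: (GM) => //; exact: GV.
    by apply/funext => i /=; rewrite alM ?he -?ge ?alKV //; exact: GV.
  by rewrite -(mulVKg g h) e1 mulg1.
move=> [x [N [[[N1 NM NV] NH NJ] Nab Nneq]]].
have NG n : N n -> G n by move=> /NH[].
have Nx n : N n -> al n x = x by move=> /NH[].
(* Let tau swap y and n y and fix x: then n^tau n fixes x, y and n y, so it is 1 and
   tau n is an involution fixing x and y, hence also trivial. *)
have invol n : N n -> n <> 1 -> has_sign iota beta true n /\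
    exists y, [/\ al n y <> y, y <> x & al n y <> x].
  move=> Nn n1; have Gn := NG _ Nn.
  have [y ny] : exists y, al n y <> y.
    apply: contrapT => /forallNP h; apply: n1; apply: (faith _ _ base_inj) => //.
    by apply/funext => i; apply: contrapT; exact: h.
  have yx : y <> x by move=> e; apply: ny; rewrite e Nx.
  have nyx : al n y <> x by rewrite -(Nx _ Nn) => /(al_inj _ Gn).
  have yny : y <> al n y by move=> e; apply: ny.
  have [tau [Gt ty tny tx]] := tr33 _ _ _ _ _ _ yny nyx yx ny yx nyx.
  have t2 : tau * tau = 1.
    by apply: (faith3 _ _ _ _ (GM _ _ Gt Gt) yny nyx yx); rewrite alM ?ty ?tny ?tx ?ty.
  have tV : tau^-1 = tau by apply: mulg1_eq.
  pose m := (n ^ tau) * n.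
  have Nnt : N (n ^ tau) by apply: (NJ).
  have Nm : N m by exact: NM.
  have Gnt := NG _ Nnt.
  have my : al m y = y.
    rewrite alM // conjgE tV alM //; last exact: GM.
    by rewrite alM // !tny.
  have m1 : m = 1.
    apply: (faith3 _ _ _ _ (NG _ Nm) yny nyx yx) => //; last exact: Nx.
    have Gm := NG _ Nm.
    by rewrite -(alM m n) // (Nab m n) // (alM n m) // my.
  have [tn1|tn1] := pselect (tau * n = 1).
    have <- : tau = n by rewrite -(mulKg tau n) tn1 mulg1 tV.
    by have [] := swap _ _ _ _ Gt yny nyx yx ty tny tx; split=> //; exists y; rewrite ty.
  exfalso; have Gtn : G (tau * n) by exact: GM.
  have tny' : al (tau * n) y = y by rewrite alM.
  have tnx : al (tau * n) x = x by rewrite alM // Nx.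
  have tn2 : (tau * n) * (tau * n) = 1.
    by move: m1; rewrite /m conjgE tV !mulgA.
  (* By [swap], the involution [tau * n] swapping [a] with its image has [x] as its only fixed
     point, but it also fixes [y]. *)
  have [a na] : exists a, al (tau * n) a <> a.
    apply: contrapT => /forallNP h; apply: tn1; apply: (faith _ _ base_inj) => //.
    by apply/funext => i; apply: contrapT; exact: h.
  have ax : a <> x by move=> e; apply: na; rewrite e.
  have tnax : al (tau * n) a <> x by rewrite -tnx => /(al_inj _ Gtn).
  have [_ /(_ y tny')] := swap _ _ _ _ Gtn (nesym na) tnax ax erefl
    (etrans (esym (alM _ _ _ Gtn Gtn)) (etrans (congr1 (al^~ a) tn2) (al1 a))) tnx.
  exact: yx.
have [n [Nn n1]] : exists n, N n /\ n <> 1.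
  apply: contrapT => h; apply: Nneq; apply/seteqP; split=> [n Nn|_ -> //].
  by apply: contrapT => n1; apply: h; exists n.
(* The quotient of two odd elements is even, so by [invol] it cannot be a nontrivial element of
   [N]. *)
have only n' : N n' -> n' <> 1 -> n' = n.
  move=> Nn' n1'; apply: contrapT => ne.
  have Nq : N (n^-1 * n') by apply: (NM) => //; exact: NV.
  have [h _] := invol _ Nn n1; have [h' _] := invol _ Nn' n1'.
  have [|hq _] := invol _ Nq.
    by move=> e; apply: ne; rewrite -(mulVKg n n') e mulg1.
  have := has_signM iotaM beta_compatible (has_signV iota1 iotaM beta_compatible h) h'.
  by move=> /(has_sign_uniq iota1 iotaM beta_compatible free hq).
have [_ [y [ny yx nyx]]] := invol _ Nn n1.
(* An element [h] fixing [x] and [y] and sending [al n y] to a fourth point [z] conjugates [n] to an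
   element of [N] sending [y] to [z], which is neither [n] nor 1. *)
have [z [[zx zy] zny]] : exists z, (z <> x /\ z <> y) /\ z <> al n y.
  apply: contrapT => h.
  have big i : inl i = x \/ inl i = y \/ inl i = al n y :> space.
    by apply: contrapT => /not_orP[? /not_orP[? ?]]; apply: h; exists (inl i).
  have big' : fresh 0 = x \/ fresh 0 = y \/ fresh 0 = al n y :> space.
    by apply: contrapT => /not_orP[? /not_orP[? ?]]; apply: h; exists (fresh 0).
  by case: (big p0) (big p1) (big p2) big' => [|[]] <- [|[]] // <- [|[]] // <- [|[]].
have [h [Gh hx hy hny]] := tr33 x y (al n y) x y z (nesym yx) (nesym ny) (nesym nyx)
  (nesym yx) (nesym zy) (nesym zx).
have Nj : N (n ^ h^-1).
  apply: (NJ) => //; split; first exact: GV.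
  by rewrite -{1}hx alKV.
have ej y' : al (n ^ h^-1) y' = al h (al n (al h^-1 y')).
  by rewrite conjgE invgK !alM //; do ?[exact: NG|exact: GV|apply: (GM)].
have := only _ Nj => /(_ _)/(congr1 (fun g => al g y)) e.
apply: zny; rewrite -e ?ej.
  by rewrite -{1}hy alKV // hny.
move=> e1; have := ej y; rewrite e1 al1 -{2}hy alKV // hny => e2.
by apply: zy; rewrite -e2.
Qed.

End Action.

(** * A free family in SL(4, Z) *)

Local Open Scope ring_scope.

Definition mat2 (a b c d : int) : 'M[int]_2 :=
  \matrix_(i, j) if i == 0 then (if j == 0 then a else b) else (if j == 0 then c else d).

Lemma mat2M a b c d a' b' c' d' : mat2 a b c d *m mat2 a' b' c' d' =
  mat2 (a * a' + b * c') (a * b' + b * d') (c * a' + d * c') (c * b' + d * d').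
Proof.
apply/matrixP => i j; rewrite !mxE !big_ord_recl big_ord0 !mxE /= addr0.
by case: i j => [[|[|//]]] ? [[|[|//]]] ?.
Qed.

Lemma mat2B a b c d a' b' c' d' : mat2 a b c d - mat2 a' b' c' d' =
  mat2 (a - a') (b - b') (c - c') (d - d').
Proof. by apply/matrixP => i j; rewrite !mxE; do !case: eqP. Qed.

Definition normsq (x : 'cV[int]_2) : int := x 0 0 ^+ 2 + x 1 0 ^+ 2.

Lemma normsq_ge0 x : 0 <= normsq x.
Proof. by rewrite addr_ge0 ?sqr_ge0. Qed.

Lemma normsq0 : normsq 0 = 0.
Proof. by rewrite /normsq !mxE. Qed.

Lemma normsq_gt0 x : x != 0 -> 0 < normsq x.
Proof.
move=> xN; rewrite lt_neqAle normsq_ge0 andbT eq_sym; apply: contra xN.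
rewrite paddr_eq0 ?sqr_ge0 // !sqrf_eq0 => /andP[/eqP h0 /eqP h1].
apply/eqP/matrixP => i j; rewrite ord1 mxE.
by case: i => [[|[|//]]] h; [rewrite -h0|rewrite -h1]; congr (x _ _); apply: val_inj.
Qed.

Lemma normsqZ a x : normsq (a *: x) = a ^+ 2 * normsq x.
Proof. by rewrite /normsq !mxE; ring. Qed.

(** The parallelogram law for [x + y] and [y], replacing the triangle inequality so as to avoid
    square roots. *)
Lemma normsqD_ge x y : normsq x <= 2 * normsq (x + y) + 2 * normsq y.
Proof.
have -> : normsq x = 2 * normsq (x + y) + 2 * normsq y - normsq (x + 2 *: y).
  by rewrite /normsq !mxE; ring.
by rewrite gerBl normsq_ge0.
Qed.

Lemma normsq_mat2 a b c d x : normsq (mat2 a b c d *m x) =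
  (a * x 0 0 + b * x 1 0) ^+ 2 + (c * x 0 0 + d * x 1 0) ^+ 2.
Proof.
rewrite /normsq !mxE !big_ord_recl !big_ord0 !mxE /= !addr0.
by have -> : lift ord0 ord0 = 1 :> 'I_2 by apply: val_inj.
Qed.

(* Positivity of the binary form [|delta x|^2 - 4 |x|^2] by its discriminant. *)
Lemma mat2_expand a b c d x :
  4 < a ^+ 2 + c ^+ 2 ->
  (a * b + c * d) ^+ 2 <= (a ^+ 2 + c ^+ 2 - 4) * (b ^+ 2 + d ^+ 2 - 4) ->
  4 * normsq x <= normsq (mat2 a b c d *m x).
Proof.
rewrite normsq_mat2 /normsq; set u := x 0 0; set v := x 1 0 => h1 h2.
set A := a ^+ 2 + c ^+ 2 - 4 in h2; set B := a * b + c * d in h2.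
set C := b ^+ 2 + d ^+ 2 - 4 in h2.
have A0 : 0 < A by rewrite subr_gt0.
rewrite -subr_ge0 -(pmulr_rge0 _ A0).
have -> : A * ((a * u + b * v) ^+ 2 + (c * u + d * v) ^+ 2 - 4 * (u ^+ 2 + v ^+ 2)) =
  (A * u + B * v) ^+ 2 + (A * C - B ^+ 2) * v ^+ 2 by rewrite /A /B /C; ring.
by rewrite addr_ge0 ?sqr_ge0 // mulr_ge0 ?sqr_ge0 // subr_ge0.
Qed.

(** The Cauchy-Schwarz inequality on each row, through Lagrange's identity. *)
Lemma mat2_bound a b c d x :
  normsq (mat2 a b c d *m x) <= (a ^+ 2 + b ^+ 2 + c ^+ 2 + d ^+ 2) * normsq x.
Proof.
rewrite normsq_mat2 /normsq; set u := x 0 0; set v := x 1 0.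
rewrite -subr_ge0.
have -> : (a ^+ 2 + b ^+ 2 + c ^+ 2 + d ^+ 2) * (u ^+ 2 + v ^+ 2) -
  ((a * u + b * v) ^+ 2 + (c * u + d * v) ^+ 2) = (a * v - b * u) ^+ 2 + (c * v - d * u) ^+ 2.
  by ring.
by rewrite addr_ge0 ?sqr_ge0.
Qed.

(* The action of S_3 on the quotient of Z^3 by the diagonal. *)
Definition rep (s : s3) : 'M[int]_2 :=
  match s with
  | s3e => mat2 1 0 0 1 | s3t01 => mat2 0 1 1 0 | s3t12 => mat2 1 (-1) 0 (-1)
  | s3t02 => mat2 (-1) 0 (-1) 1 | s3c => mat2 0 (-1) 1 (-1)
  | s3cc => mat2 (-1) 1 (-1) 0
  end.

Lemma rep1 : rep s3e = 1%:M.
Proof.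
by apply/matrixP => i j; rewrite !mxE; case: i j => [[|[|//]]] ? [[|[|//]]] ?.
Qed.

Lemma repM s t : rep (s3_mul s t) = rep s *m rep t.
Proof. by case: s; case: t; rewrite /= mat2M. Qed.

Lemma rep_inj s : rep s = 1%:M -> s = s3e.
Proof.
rewrite -rep1 => /matrixP e; have := (e 0 0, e 0 1, e 1 0, e 1 1).
by case: s {e}; rewrite /= !mxE /= => -[[[]]].
Qed.

(* The kinds are represented by eleven matrices permuted by conjugation by S_3,
   all of whose differences expand norms by a factor at least 2. *)
Definition entries (k : kind) : int * int * int * int :=
  match k with
  | Kalt false => (1, -2, 2, -1) | Kalt true => (-1, 2, -2, 1)
  | Kpt p0 => (5, -5, 0, -5) | Kpt p1 => (-5, 0, -5, 5) | Kpt p2 => (0, 5, 5, 0)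
  | Kfree s3e => (-6, 4, -2, 6) | Kfree s3t01 => (6, -2, 4, -6)
  | Kfree s3t12 => (-4, 6, 2, 4) | Kfree s3t02 => (-2, -4, -6, 2)
  | Kfree s3c => (4, 2, 6, -4) | Kfree s3cc => (2, -6, -4, -2)
  end.

Definition kmat (k : kind) : 'M[int]_2 :=
  let: (a, b, c, d) := entries k in mat2 a b c d.

Lemma kmat_act s k : rep s *m kmat k = kmat (kind_act s k) *m rep s.
Proof.
by case: k => [[]|[]|[]]; case: s; rewrite /kmat /= !mat2M.
Qed.

Definition entries_diff (k k' : kind) : int * int * int * int :=
  let: (a, b, c, d) := entries k in let: (a', b', c', d') := entries k' in
  (a - a', b - b', c - c', d - d').

Definition expanding (m : int * int * int * int) : bool :=
  let: (a, b, c, d) := m in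
  (4 < a ^+ 2 + c ^+ 2) && ((a * b + c * d) ^+ 2 <=
    (a ^+ 2 + c ^+ 2 - 4) * (b ^+ 2 + d ^+ 2 - 4)).

Definition bounded (m : int * int * int * int) : bool :=
  let: (a, b, c, d) := m in a ^+ 2 + b ^+ 2 + c ^+ 2 + d ^+ 2 <= 400.

Lemma entries_expand k k' : (k != k') ==> expanding (entries_diff k k').
Proof.
by case: k => [[]|[]|[]]; case: k' => [[]|[]|[]]; vm_compute; reflexivity.
Qed.

Lemma entries_bounded k k' : bounded (entries_diff k k').
Proof.
by case: k => [[]|[]|[]]; case: k' => [[]|[]|[]]; vm_compute; reflexivity.
Qed.

Lemma kmat_expand k k' x : k != k' -> 4 * normsq x <= normsq ((kmat k - kmat k') *m x).
Proof.
move=> kk; rewrite /kmat; have := implyP (entries_expand k k') kk; rewrite /expanding /entries_diff.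
case: (entries k) => [[[a b] c] d]; case: (entries k') => [[[a' b'] c'] d'].
by rewrite mat2B => /andP[]; exact: mat2_expand.
Qed.

Lemma kmat_bound k k' x : normsq ((kmat k - kmat k') *m x) <= 400 * normsq x.
Proof.
rewrite /kmat; have := entries_bounded k k'; rewrite /bounded /entries_diff.
case: (entries k) => [[[a b] c] d]; case: (entries k') => [[[a' b'] c'] d'].
rewrite mat2B => h; apply: le_trans (mat2_bound _ _ _ _ _) _.
by apply: ler_wpM2r h; exact: normsq_ge0.
Qed.

(** Scalars commute with [rep], so the shift respects equivariance. It separates different indices:
    by [normsqD_ge] the squared norm grows at least by (900 - 2 * 400) / 2 = 50, where 400 comes
    from [kmat_bound]. *)
Definition alpha (b : letter) : 'M[int]_2 := (30 * b.1%:R)%:M + kmat b.2.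

Lemma alpha_act s b : rep s *m alpha b = alpha (lact s b) *m rep s.
Proof. by rewrite mulmxDr mulmxDl scalar_mxC kmat_act. Qed.

Lemma alpha_expand b b' x : b <> b' -> 4 * normsq x <= normsq ((alpha b - alpha b') *m x).
Proof.
case: b b' => [n k] [n' k'] bb; rewrite /alpha /= opprD addrACA -raddfB /= -mulrBr.
have [e|ne] := eqVneq n n'.
  subst n'; rewrite subrr mulr0 raddf0 add0r; apply: kmat_expand; apply/eqP => e.
  by apply: bb; rewrite e.
set N : int := n%:R - n'%:R.
have N1 : 1 <= N ^+ 2.
  by rewrite -gtz0_ge1 exprn_even_gt0 //= subr_eq0 eqr_nat.
rewrite mulmxDl mul_scalar_mx; set y := _ *m x.
have h1 := normsqD_ge ((30 * N) *: x) y; have h2 : normsq y <= _ := kmat_bound k k' x.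
have h3 := normsq_ge0 x.
have h4 : normsq x <= N ^+ 2 * normsq x by rewrite ler_peMl.
have e : normsq ((30 * N) *: x) = 900 * (N ^+ 2 * normsq x) by rewrite normsqZ; ring.
by rewrite {}e in h1; lra.
Qed.

(** * Block shears and ping-pong *)

Definition upper (a : 'M[int]_2) : 'M[int]_(2 + 2) := block_mx 1%:M a 0 1%:M.
Definition lower (a : 'M[int]_2) : 'M[int]_(2 + 2) := block_mx 1%:M 0 a 1%:M.
Definition diag2 (a : 'M[int]_2) : 'M[int]_(2 + 2) := block_mx a 0 0 a.

Lemma det_upper a : \det (upper a) = 1.
Proof. by rewrite det_ublock !det1 mulr1. Qed.

Lemma det_lower a : \det (lower a) = 1.
Proof. by rewrite det_lblock !det1 mulr1. Qed.

Lemma det_mat2 a b c d : \det (mat2 a b c d) = a * d - b * c.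
Proof.
rewrite (expand_det_row _ 0) !big_ord_recl big_ord0 /cofactor !det_mx11 !mxE /=.
by rewrite expr0 expr1 mul1r addr0 mulN1r mulrN.
Qed.

Lemma det_diag2_rep s : \det (diag2 (rep s)) = 1.
Proof. by rewrite det_ublock; case: s; rewrite /= det_mat2. Qed.

Lemma upperD a b : upper a *m upper b = upper (a + b).
Proof. by rewrite mulmx_block !mulmx0 !mul0mx !mulmx1 !mul1mx !addr0 add0r addrC. Qed.

Lemma lowerD a b : lower a *m lower b = lower (a + b).
Proof. by rewrite mulmx_block !mulmx0 !mul0mx !mulmx1 !mul1mx !addr0 ?add0r. Qed.

Lemma diag2M a b : diag2 a *m diag2 b = diag2 (a *m b).
Proof. by rewrite mulmx_block !mulmx0 !mul0mx !addr0 add0r. Qed.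

Lemma upper0 : upper 0 = 1%:M. Proof. by rewrite /upper -scalar_mx_block. Qed.
Lemma lower0 : lower 0 = 1%:M. Proof. by rewrite /lower -scalar_mx_block. Qed.
Lemma diag21 : diag2 1%:M = 1%:M. Proof. by rewrite /diag2 -scalar_mx_block. Qed.

Lemma upper_col a (x y : 'cV_2) : upper a *m col_mx x y = col_mx (x + a *m y) y.
Proof. by rewrite mul_block_col !mul1mx mul0mx add0r. Qed.

Lemma lower_col a (x y : 'cV_2) : lower a *m col_mx x y = col_mx x (y + a *m x).
Proof. by rewrite mul_block_col !mul1mx mul0mx addr0 addrC. Qed.

Lemma diag2_col a (x y : 'cV_2) : diag2 a *m col_mx x y = col_mx (a *m x) (a *m y).
Proof. by rewrite mul_block_col !mul0mx addr0 add0r. Qed.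

Lemma diag2_upper r a a' : r *m a = a' *m r -> diag2 r *m upper a = upper a' *m diag2 r.
Proof.
by move=> e; rewrite !mulmx_block !mulmx0 !mul0mx !mulmx1 !mul1mx !addr0 !add0r e.
Qed.

Lemma diag2_lower r c : diag2 r *m lower c%:M = lower c%:M *m diag2 r.
Proof.
by rewrite !mulmx_block !mulmx0 !mul0mx !mulmx1 !mul1mx !addr0 !add0r scalar_mxC.
Qed.

Definition shear (c : int) (b : letter) : 'M[int]_(2 + 2) :=
  upper (alpha b) *m lower c%:M *m upper (- alpha b).

Lemma det_shear c b : \det (shear c b : 'M_4) == 1.
Proof. by rewrite !det_mulmx !det_upper det_lower !mulr1. Qed.

Lemma shearD c d b : shear c b *m shear d b = shear (c + d) b.
Proof.
rewrite /shear -!mulmxA; congr (_ *m _).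
by rewrite (mulmxA (upper (- _))) upperD addNr upper0 mul1mx !mulmxA lowerD -raddfD.
Qed.

Lemma shear0 b : shear 0 b = 1%:M.
Proof. by rewrite /shear raddf0 lower0 mulmx1 upperD subrr upper0. Qed.

Lemma det_rep s : \det (diag2 (rep s) : 'M_4) == 1.
Proof. by rewrite det_diag2_rep. Qed.

Definition slv (c : int) (b : letter) : SL 4 int := exist _ (shear c b) (det_shear c b).
Definition sl_iota (s : s3) : SL 4 int := exist _ (diag2 (rep s)) (det_rep s).
Definition sl_beta (b : letter) : SL 4 int := slv 2 b.

Lemma sl_iota1 : sl_iota s3e = 1%g.
Proof. by apply: val_inj; exact: etrans (congr1 diag2 rep1) diag21. Qed.

Lemma sl_iotaM s t : sl_iota (s3_mul s t) = (sl_iota s * sl_iota t)%g.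
Proof. by apply: val_inj; rewrite /= repM -diag2M. Qed.

Lemma diag2_shear s c b :
  diag2 (rep s) *m shear c b = shear c (lact s b) *m diag2 (rep s).
Proof.
rewrite /shear !mulmxA (diag2_upper (alpha_act s b)) -!mulmxA; congr (_ *m _).
rewrite mulmxA diag2_lower -!mulmxA; congr (_ *m _); apply: diag2_upper.
by rewrite mulmxN mulNmx alpha_act.
Qed.

Lemma sl_compatible : compatible sl_iota sl_beta.
Proof. by move=> s b; apply: val_inj; exact: diag2_shear. Qed.

Definition letter_coef (l : signed_letter) : int := if l.2 then 2 else - 2.

Lemma sl_leval l : leval sl_beta l = slv (letter_coef l) l.1.
Proof.
case: l => b [] //=; rewrite /leval /=; apply: mulg1_eq.
by apply: val_inj; rewrite /= shearD subrr shear0.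
Qed.

(* The ping-pong table: the vectors reached after applying the letter [l]. *)
Definition reached (l : signed_letter) (v : 'cV[int]_(2 + 2)) : Prop :=
  exists (x y : 'cV[int]_2) (k : nat), [/\ (0 < k)%N, normsq y < normsq x &
    v = upper (alpha l.1) *m col_mx x (y + (letter_coef l * k%:R) *: x)].

(** In the coordinates of the letter, adding a multiple of [x] by a factor of absolute value at
    least 2 to the shorter vector [y] makes it longer than [x]. *)
Lemma reached_large l v : reached l v -> exists x y,
  normsq x < normsq y /\ v = upper (alpha l.1) *m col_mx x y.
Proof.
move=> [x [y [k [k0 yx ->]]]]; exists x; eexists; split; last reflexivity.
set c := letter_coef l * _.
have h := normsqD_ge (c *: x) y; rewrite addrC; rewrite normsqZ in h.
have c4 : 4 <= c ^+ 2.
  rewrite /c exprMn; have -> : letter_coef l ^+ 2 = 4 by rewrite /letter_coef; case: l.2.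
  by rewrite -natrX ler_peMr // ler1n expn_gt0 k0.
have : 4 * normsq x <= c ^+ 2 * normsq x by rewrite ler_wpM2r ?normsq_ge0.
by lra.
Qed.

Lemma reached_first l x : x != 0 ->
  reached l (shear (letter_coef l) l.1 *m col_mx x 0).
Proof.
move=> x0; exists x, 0, 1%N; rewrite normsq0 normsq_gt0 // mulr1; split=> //.
by rewrite -!mulmxA upper_col mulmx0 addr0 lower_col mul_scalar_mx.
Qed.

(** Repeating a letter raises the count [k] by one. For another letter, the change of coordinates
    adds the image of the longer half [y] under a matrix which at least doubles norms, so the first
    half becomes the longer one. *)
Lemma reached_step l l' v : ~~ reducible l l' -> reached l' v ->
  reached l (shear (letter_coef l) l.1 *m v).
Proof.
move=> red; have [e|ne] := eqVneq l.1 l'.1.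
  have el : l = l'.
    move: red; rewrite /reducible e eqxx /= negbK => /eqP e2.
    by case: l l' e e2 => ? ? [? ?] /= -> ->.
  subst l' => -[x [y [k [k0 yx ->]]]]; exists x, y, k.+1; split=> //.
  rewrite -!mulmxA (mulmxA (upper (- _))) upperD addNr upper0 mul1mx lower_col.
  by rewrite mul_scalar_mx -addrA -scalerDl -natr1 mulrDr mulr1.
move=> /reached_large[x [y [xy ->]]].
exists (x + (alpha l'.1 - alpha l.1) *m y), y, 1%N; split=> //.
  have h := normsqD_ge ((alpha l'.1 - alpha l.1) *m y) x; rewrite addrC.
  have : 4 * normsq y <= normsq ((alpha l'.1 - alpha l.1) *m y).
    by apply: alpha_expand => e; rewrite e eqxx in ne.
  by lra.
rewrite -!mulmxA (mulmxA (upper (- _))) upperD upper_col lower_col mul_scalar_mx mulr1.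
by rewrite [- alpha _ + _]addrC.
Qed.

Lemma sl_free : free_letters sl_iota sl_beta.
Proof.
move=> w s; case: w => [_|l w red e].
  rewrite mul1g => /(congr1 val) e; split=> //; apply: rep_inj.
  have {}e : diag2 (rep s) = 1%:M by exact: e.
  by move: e; rewrite -diag21 => /eq_block_mx[].
(* The word would send [col_mx (rep s *m x) 0] to [col_mx x 0], whose second half is zero, although
   a vector reached by a nonempty reduced word has a nonzero second half. *)
exfalso; pose x : 'cV[int]_2 := const_mx 1.
have x0 : x != 0 by apply/eqP => /matrixP/(_ 0 0); rewrite !mxE.
have sx0 : rep s *m x != 0.
  apply: contra x0 => /eqP h; rewrite -[x]mul1mx -rep1 -(s3_mulVs s) repM -mulmxA h.
  by rewrite mulmx0.
have key : reached l (val (weval sl_beta (l :: w)) *m col_mx (rep s *m x) 0).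
  elim: w l red {e} => [|l' w IH] l /= red.
    by rewrite mulmx1 sl_leval; exact: reached_first.
  have /andP[r1 r2] := red; rewrite sl_leval /= -mulmxA.
  by apply: reached_step r1 _; exact: IH.
have [u [y [uy]]] := reached_large key.
have {}e : val (weval sl_beta (l :: w)) *m diag2 (rep s) = 1%:M by exact: (congr1 val e).
have -> : col_mx (rep s *m x) 0 = diag2 (rep s) *m col_mx x 0 by rewrite diag2_col mulmx0.
rewrite mulmxA e mul1mx upper_col => /eq_col_mx[_ y0].
by have := normsq_ge0 u; rewrite leNgt -normsq0 y0 uy.
Qed.

(** * Centralisers of elements of order three in SL(3, Z) *)

Local Open Scope classical_set_scope.
Local Open Scope ring_scope.

Lemma finite_set_injective (T U : Type) (A : set T) (B : set U) (f : T -> U) :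
  (forall x, A x -> B (f x)) -> (forall x y, A x -> A y -> f x = f y -> x = y) ->
  finite_set B -> finite_set A.
Proof.
move=> AB fI fB; have [[x0 Ax0]|A0] := pselect (exists x, A x); last first.
  by apply: sub_finite_set (finite_set0 _) => x Ax; apply: A0; exists x.
have ex u : exists y, (exists x, A x /\ f x = u) -> A y /\ f y = u.
  by have [[x hx]|nx] := pselect (exists x, A x /\ f x = u); [exists x|exists x0].
have [g gP] := choice ex.
apply: sub_finite_set (finite_image g fB) => x Ax; exists (f x); first exact: AB.
have [Ag fg] := gP (f x) (ex_intro _ x (conj Ax erefl)).
exact: fI.
Qed.

Definition cyc3 : 'M[rat]_3 := \matrix_(i, j) (j == i.+1 %% 3 :> nat)%N%:R.

Lemma sum3 (R : nmodType) (F : 'I_3 -> R) :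
  \sum_i F i = F 0 + F 1 + F (inord 2).
Proof.
rewrite !big_ord_recl big_ord0 addr0 addrA; congr (_ + F _ + F _).
  exact: val_inj.
by apply: val_inj; rewrite /= inordK.
Qed.

Lemma ord3P (P : 'I_3 -> Prop) : P 0 -> P 1 -> P (inord 2) -> forall i, P i.
Proof.
move=> h0 h1 h2 i; case: i => -[|[|[|//]]] hi.
- by have -> : Ordinal hi = 0 by apply: val_inj.
- by have -> : Ordinal hi = 1 by apply: val_inj.
- by have -> : Ordinal hi = inord 2 by apply: val_inj; rewrite /= inordK.
Qed.

(* With [u] fixed by C and [w] in its nontrivial part, [u + w] is a cyclic vector. *)
Lemma cyclic_vector (C : 'M[rat]_3) : C *m C *m C = 1%:M -> C <> 1%:M ->
  exists2 M, M \in unitmx & M *m C = cyc3 *m M.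
Proof.
move=> C3 C1; pose P := 1%:M + C + C *m C.
have PC : P *m C = P.
  by rewrite !mulmxDl C3 mul1mx addrC addrA.
have P0 : P != 0.
  (* If [P] were 0, then [D] would square to -3, and its rational determinant would have the square
     -27. *)
  apply/eqP => P0; pose D := 1%:M + C *+ 2.
  have DD : D *m D = (- 3)%:M.
    have -> : D *m D = P *+ 4 - 3%:M; last by rewrite P0 mul0rn add0r raddfN.
    rewrite /D /P mulr2n !mulmxDl !mulmxDr !mul1mx !mulmx1; set CC := C *m C.
    by apply/matrixP => i j; rewrite !mxE; case: (i == j); rewrite ?mulr0n ?mulr1n; ring.
  have := congr1 determinant DD; rewrite det_mulmx det_scalar.
  have := sqr_ge0 (\det D); rewrite expr2 => + e; rewrite e.
  by [].
have nz (A : 'M[rat]_3) : A != 0 -> exists v : 'rV_3, v *m A != 0.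
  move=> A0; apply: contrapT => /forallNP h; case/eqP: A0.
  apply/row_matrixP => i; rewrite row0 rowE; apply/eqP/negPn/negP; exact: h.
have [v1 u0] := nz _ P0.
have [|v0 w0] := nz (C - 1%:M).
  by apply/eqP => /subr0_eq.
set u := v1 *m P in u0; set w := v0 *m (C - 1%:M) in w0.
have uC : u *m C = u by rewrite -mulmxA PC.
have wP : w *m P = 0.
  rewrite -mulmxA mulmxBl mul1mx.
  have -> : C *m P = P by rewrite !mulmxDr mulmx1 !mulmxA C3 addrC addrA.
  by rewrite subrr mulmx0.
have wCC : w *m C *m C = - w - w *m C.
  move: wP; rewrite !mulmxDr mulmx1 mulmxA => /eqP; rewrite addrC addr_eq0 => /eqP ->.
  by rewrite opprD.
pose v := u + w.
pose M : 'M[rat]_3 := \matrix_(i < 3) if i == 0 then v else if i == 1 then v *m C else v *m C *m C.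
have r0 : row 0 M = v by rewrite rowK.
have r1 : row 1 M = v *m C by rewrite rowK.
have r2 : row (inord 2) M = v *m C *m C.
  rewrite rowK; have -> : (inord 2 == 0 :> 'I_3) = false by rewrite -val_eqE /= inordK.
  by have -> : (inord 2 == 1 :> 'I_3) = false by rewrite -val_eqE /= inordK.
exists M.
  rewrite -row_free_unit -kermx_eq0; apply/rowV0P => x /sub_kermxP xM.
  have : x 0 0 *: v + x 0 1 *: (v *m C) + x 0 (inord 2) *: (v *m C *m C) = 0.
    by rewrite -xM [RHS]mulmx_sum_row sum3 r0 r1 r2.
  set a := x 0 0; set b := x 0 1; set c := x 0 (inord 2).
  rewrite /v !mulmxDl !uC wCC => e.
  have e' : (a + b + c) *: u + ((a - c) *: w + (b - c) *: (w *m C)) = 0.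
    by rewrite -e; apply/matrixP => i j; rewrite !mxE; ring.
  have uP : u *m P = 3 *: u.
    by rewrite !mulmxDr mulmx1 mulmxA !uC; apply/matrixP => i j; rewrite !mxE; ring.
  have CP : C *m P = P *m C by rewrite !mulmxDr !mulmxDl !mulmx1 !mul1mx !mulmxA.
  have wCP : w *m C *m P = 0 by rewrite -mulmxA CP mulmxA wP mul0mx.
  (* Applying [P] kills the part in [w] and multiplies [u] by 3. *)
  have abc : a + b + c = 0.
    have := congr1 (mulmx^~ P) e'; rewrite mul0mx !mulmxDl -!scalemxAl uP wP wCP.
    rewrite !scaler0 !addr0 scalerA => /eqP; rewrite scaler_eq0 (negbTE u0) orbF.
    by rewrite mulf_eq0 orbF => /eqP.
  rewrite abc scale0r add0r in e'.
  (* Otherwise [w] is an eigenvector whose eigenvalue is a rational root of [1 + mu + mu ^+ 2],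
     which is positive. *)
  have bc : b - c = 0.
    apply/eqP/negPn/negP => bc0; pose mu := - (a - c) / (b - c).
    have wC : w *m C = mu *: w.
      apply: (scalerI bc0); rewrite scalerA /mu mulrC divfK //.
      by apply/eqP; rewrite -subr_eq0 -scaleNr opprK addrC; apply/eqP.
    have mu3 : mu ^+ 3 = 1.
      have : w = mu ^+ 3 *: w.
        rewrite -{1}[w]mulmx1 -C3 !mulmxA wC -!scalemxAl wC -!scalemxAl wC !scalerA.
        by rewrite !exprS expr0 mulr1 !mulrA.
      move=> /eqP; rewrite -subr_eq0 -{1}[w]scale1r -scalerBl scaler_eq0 (negbTE w0) orbF.
      by rewrite subr_eq0 => /eqP.
    have mu1 : 1 + mu + mu ^+ 2 = 0.
      move: wCC; rewrite wC -scalemxAl wC scalerA => /eqP; rewrite -subr_eq0.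
      have -> : (mu * mu) *: w - (- w - mu *: w) = (1 + mu + mu ^+ 2) *: w.
        by apply/matrixP => i j; rewrite !mxE; ring.
      by rewrite scaler_eq0 (negbTE w0) orbF => /eqP.
    by have := sqr_ge0 (mu * 2 + 1); have := sqr_ge0 mu; nra.
  have ac : a - c = 0.
    by move: e'; rewrite bc scale0r addr0 => /eqP; rewrite scaler_eq0 (negbTE w0) orbF => /eqP.
  have [a0 b0 c0] : [/\ a = 0, b = 0 & c = 0] by split; lra.
  by apply/rowP; apply: ord3P; rewrite mxE.
apply/row_matrixP => i; rewrite !row_mul.
have rz : row i cyc3 = delta_mx 0 (inord (i.+1 %% 3)).
  by apply/rowP => j; rewrite !mxE eqxx -val_eqE /= inordK // ltn_mod.
rewrite rz -rowE; move: i {rz}; apply: ord3P.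
- rewrite r0 (_ : inord _ = 1) ?r1 //; by apply: val_inj; rewrite /= inordK.
- by rewrite r1 (_ : inord _ = inord 2) ?r2.
- rewrite r2 (_ : inord _ = 0); last by apply: val_inj; rewrite /= !inordK.
  by rewrite r0 -!mulmxA (mulmxA C) C3 mulmx1.
Qed.

(** Twice the left side is [p + q + r] times the sum of the squared differences. These are positive
    integers with product 54, hence bounded. The 27 comes from tripling the entries of a circulant
    matrix of determinant 1. *)
Lemma circulant_bound (p q r : int) :
  p ^+ 3 + q ^+ 3 + r ^+ 3 - 3 * p * q * r = 27 ->
  [/\ `|p| <= 100, `|q| <= 100 & `|r| <= 100].
Proof.
move=> e; pose s := p + q + r; pose f := (p - q) ^+ 2 + (q - r) ^+ 2 + (r - p) ^+ 2.
have sf : s * f = 54 by transitivity (2 * 27 : int) => //; rewrite -e /s /f; ring.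
have f0 : 0 <= f by rewrite !addr_ge0 ?sqr_ge0.
have fN : f != 0 by apply/eqP => f1; rewrite f1 mulr0 in sf.
have f1 : 1 <= f by rewrite -gtz0_ge1 lt0r fN.
have s1 : 1 <= s.
  by rewrite -gtz0_ge1 -(pmulr_lgt0 s (x := f)) ?sf // lt0r fN.
have s54 : s <= 54 by rewrite -sf ler_peMr // (le_trans _ s1).
have f54 : f <= 54 by rewrite -sf ler_peMl.
have small (x : int) : x ^+ 2 <= 54 -> `|x| <= 8.
  move=> h; rewrite leNgt; apply/negP => h9; suff : 81 <= x ^+ 2 by lia.
  rewrite -(real_normK (num_real x)); apply: (@le_trans _ _ (9 ^+ 2)) => //.
  by rewrite ler_sqr ?nnegrE //; lia.
have h1 := small (p - q); have h2 := small (q - r); have h3 := small (r - p).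
have g1 := sqr_ge0 (p - q); have g2 := sqr_ge0 (q - r); have g3 := sqr_ge0 (r - p).
have {}h1 : `|p - q| <= 8 by apply: h1; rewrite /f in f54; lra.
have {}h2 : `|q - r| <= 8 by apply: h2; rewrite /f in f54; lra.
have {}h3 : `|r - p| <= 8 by apply: h3; rewrite /f in f54; lra.
rewrite /s in s1 s54; clear - s1 s54 h1 h2 h3.
by split; lia.
Qed.

Lemma finite_box (n : nat) : finite_set [set x : int | `|x| <= n%:Z].
Proof.
apply: sub_finite_set (finite_image (fun k : nat => k%:Z - n%:Z) (finite_II (2 * n).+1)).
move=> x /= xn; exists (absz (x + n%:Z)); last by lia.
by rewrite /=; lia.
Qed.

Lemma det_mx3 (R : comNzRingType) (A : 'M[R]_3) (o := inord 2 : 'I_3) : \det A =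
  A 0 0 * (A 1 1 * A o o - A 1 o * A o 1) - A 0 1 * (A 1 0 * A o o - A 1 o * A o 0)
  + A 0 o * (A 1 0 * A o 1 - A 1 1 * A o 0).
Proof.
have e1 : lift 0 0 = 1 :> 'I_3 by apply: val_inj.
have e2 : lift 0 1 = o :> 'I_3 by apply: val_inj; rewrite /= inordK.
have f0 : lift 1 0 = 0 :> 'I_3 by apply: val_inj.
have f1 : lift 1 1 = o :> 'I_3 by apply: val_inj; rewrite /= inordK.
have g0 : lift o 0 = 0 :> 'I_3 by apply: val_inj; rewrite /= /bump inordK.
have g1 : lift o 1 = 1 :> 'I_3 by apply: val_inj; rewrite /= /bump inordK.
have sum2 (F : 'I_2 -> R) : \sum_i F i = F 0 + F 1.
  by rewrite !big_ord_recl big_ord0 addr0; congr (_ + F _); apply: val_inj.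
have l20 : lift 0 0 = 1 :> 'I_2 by apply: val_inj.
have l21 : lift 1 0 = 0 :> 'I_2 by apply: val_inj.
have det2 (B : 'M[R]_2) : \det B = B 0 0 * B 1 1 - B 0 1 * B 1 0.
  rewrite (expand_det_row _ 0) sum2 /cofactor !det_mx11 !mxE l20 l21 /=.
  by rewrite expr0 expr1; ring.
rewrite (expand_det_row _ 0) sum3 /cofactor !det2 !mxE !e1 !e2 !f0 !f1 !g0 !g1 /= inordK //.
by rewrite expr0 expr1 sqrrN expr1n; ring.
Qed.

Lemma centralizer_finite (c : SL 3 int) : (c * c * c = 1)%g -> c <> 1%g ->
  finite_set [set g : SL 3 int | (g * c = c * g)%g].
Proof.
move=> c3 c1; pose toQ (g : SL 3 int) : 'M[rat]_3 := map_mx intr (val g).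
have toQM g h : toQ (g * h)%g = toQ g *m toQ h by rewrite /toQ -map_mxM.
have toQ_inj : injective toQ.
  move=> g h /matrixP e; apply: val_inj; apply/matrixP => i j.
  by have := e i j; rewrite !mxE => /intr_inj.
have toQ1 : toQ 1%g = 1%:M by rewrite /toQ [val _]/(1%:M) map_mx1.
have [||M Mu MC] := @cyclic_vector (toQ c).
- by rewrite -!toQM c3.
- by rewrite -toQ1 => /toQ_inj.
pose B g := M *m toQ g *m invmx M.
have AB g : toQ g = invmx M *m B g *m M by rewrite /B !mulmxA mulVmx // mul1mx mulmxKV.
have Bc : B c = cyc3 by rewrite /B MC mulmxK.
have BM g h : B (g * h)%g = B g *m B h.
  by rewrite /B toQM !mulmxA mulmxKV.
have trB g : \tr (B g) = (\tr (val g))%:~R.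
  by rewrite /B mxtrace_mulC mulmxA mulVmx // mul1mx /toQ -trace_map_mx.
have detB g : \det (B g) = 1.
  rewrite /B !det_mulmx mulrAC -det_mulmx mulmxV // det1 mul1r /toQ.
  by rewrite -[LHS]/(\det (map_mx intr (val g))) det_map_mx (eqP (valP g)).
pose o : 'I_3 := inord 2.
have val_o : o = 2%N :> nat by rewrite /o inordK.
have z i j : cyc3 i j = (j == i.+1 %% 3 :> nat)%N%:R by rewrite mxE.
(* A circulant matrix with first row [a, b, e], multiplied by the powers 0, 1, 2 of [cyc3], has
   traces [3 a], [3 e], [3 b]. Traces survive conjugation, so these are integers, and they determine
   [g]. *)
pose tr3 (g : SL 3 int) : int * int * int :=
  (\tr (val g), \tr (val (g * c)%g), \tr (val (g * c * c)%g)).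
have circ (g : SL 3 int) : (g * c = c * g)%g -> exists a b e : rat,
    [/\ 3 * a = (tr3 g).1.1%:~R, 3 * e = (tr3 g).1.2%:~R, 3 * b = (tr3 g).2%:~R,
     a ^+ 3 + b ^+ 3 + e ^+ 3 - 3 * a * b * e = 1 &
     forall i j, B g i j = [:: a; b; e]`_((j + 3 - i) %% 3)].
  move=> gc; have comm : B g *m cyc3 = cyc3 *m B g by rewrite -Bc -!BM gc.
  have sh i j : \sum_k B g i k * cyc3 k j = \sum_k cyc3 i k * B g k j.
    by have /matrixP/(_ i j) := comm; rewrite !mxE.
  have Bz A i j : (A *m cyc3) i j = A i 0 * (j == 1 :> nat)%N%:R + A i 1 * (j == 2 :> nat)%N%:R +
      A i o * (j == 0 :> nat)%N%:R :> rat.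
    by rewrite mxE sum3 !z val_o.
  have zB A i j : (cyc3 *m A) i j = (i == 2 :> nat)%N%:R * A 0 j + (i == 0 :> nat)%N%:R * A 1 j +
      (i == 1 :> nat)%N%:R * A o j :> rat.
    rewrite mxE sum3 !z val_o; case: i => -[|[|[|//]]] //=.
  have eqs i j : (B g *m cyc3) i j = (cyc3 *m B g) i j by rewrite comm.
  exists (B g 0 0), (B g 0 1), (B g 0 o).
  have e10 : B g 1 0 = B g 0 o by have := eqs 0 0; rewrite Bz zB /=; lra.
  have e11 : B g 1 1 = B g 0 0 by have := eqs 0 1; rewrite Bz zB /=; lra.
  have e12 : B g 1 o = B g 0 1 by have := eqs 0 o; rewrite Bz zB val_o /=; lra.
  have e20 : B g o 0 = B g 0 1 by have := eqs 1 0; rewrite Bz zB /=; lra.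
  have e21 : B g o 1 = B g 0 o by have := eqs 1 1; rewrite Bz zB /=; lra.
  have e22 : B g o o = B g 0 0 by have := eqs 1 o; rewrite Bz zB val_o /=; lra.
  split.
  - by rewrite -trB /mxtrace sum3 e11 e22; lra.
  - by rewrite -trB BM Bc /mxtrace sum3 !Bz val_o /= e10 e21; lra.
  - by rewrite -trB !BM Bc /mxtrace sum3 !Bz val_o /= e12 e20; lra.
  - by rewrite -[RHS](detB g) det_mx3 e10 e11 e12 e20 e21 e22; ring.
  - by apply: ord3P; apply: ord3P; rewrite ?inordK // -/o.
have box : finite_set ([set x : int | `|x| <= 100] `*` [set x : int | `|x| <= 100] `*`
    [set x : int | `|x| <= 100]).
  by do 2 ?apply: finite_setX; exact: (finite_box 100).
apply: (finite_set_injective (f := tr3) _ _ box).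
  move=> g /circ[a [b [e [ea ee eb h _]]]].
  have [] : [/\ `|(tr3 g).1.1| <= 100, `|(tr3 g).1.2| <= 100 & `|(tr3 g).2| <= 100].
    apply: circulant_bound; apply: (@intr_inj rat).
    by rewrite !(rmorphB, rmorphD, rmorphM, rmorphXn) /= -ea -ee -eb; lra.
  by [].
move=> g g' /circ[a [b [e [ea ee eb _ h]]]] /circ[a' [b' [e' [ea' ee' eb' _ h']]]] eq.
apply: toQ_inj; rewrite !AB; congr (_ *m _ *m _); apply/matrixP => i j; rewrite h h'.
have -> : a = a' by rewrite eq in ea; lra.
have -> : b = b' by rewrite eq in eb; lra.
by have -> : e = e' by rewrite eq in ee; lra.
Qed.

(** * Sharply 3-transitive groups *)

Local Open Scope classical_set_scope.
Local Open Scope group_scope.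

Lemma sharply3_finite (G : set (SL 3 int)) :
  subgroup G -> sharply_transitive 3 G -> finite_set G.
Proof.
move=> [G1 GM GV] [X [act [[act1 actM] [s sI] tr]]].
pose tup (a b c : X) : 'I_3 -> X := fun i =>
  match pt_of_ord i with p0 => a | p1 => b | p2 => c end.
have tupI a b c : a <> b -> b <> c -> a <> c -> injective (tup a b c).
  move=> ab bc ac i j; rewrite /tup => e; apply: (can_inj pt_of_ordK).
  by move: e; case: (pt_of_ord i); case: (pt_of_ord j) => // e; congruence.
have tr3 a b c a' b' c' : a <> b -> b <> c -> a <> c ->
    a' <> b' -> b' <> c' -> a' <> c' ->
    exists g, [/\ G g, act g a = a', act g b = b' & act g c = c'].
  move=> ab bc ac ab' bc' ac'.
  have [g [[Gg e] _]] := tr _ _ (tupI _ _ _ ab bc ac) (tupI _ _ _ ab' bc' ac').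
  by exists g; split=> //; [exact: (e (ord_of_pt p0))|exact: (e (ord_of_pt p1))
    |exact: (e (ord_of_pt p2))].
have same a b c g h : a <> b -> b <> c -> a <> c -> G g -> G h ->
    act g a = act h a -> act g b = act h b -> act g c = act h c -> g = h.
  move=> ab bc ac Gg Gh ea eb ec; have tI := tupI _ _ _ ab bc ac.
  have hI : injective (act h).
    by move=> p q e; rewrite -(act1 p) -(act1 q) -(mulVg h) !actM ?e //; exact: GV.
  have [k [_ uniq]] := tr _ _ tI (inj_comp hI tI).
  rewrite -(uniq g); first by apply: uniq; split.
  by split=> // i; rewrite /= /tup; case: (pt_of_ord i).
pose a := s (ord_of_pt p0); pose b := s (ord_of_pt p1); pose d := s (ord_of_pt p2).
have ab : a <> b by move=> /sI. have bd : b <> d by move=> /sI. have ad : a <> d by move=> /sI.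
have [c [Gc ca cb cd]] := tr3 _ _ _ _ _ _ ab bd ad bd (nesym ad) (nesym ab).
have Gcc : G (c * c) by exact: GM.
have c3 : c * c * c = 1.
  have Gccc : G (c * c * c) by exact: GM.
  by apply: (same _ _ _ _ _ ab bd ad Gccc G1); rewrite !actM // act1 ?ca ?cb ?cd ?ca ?cb ?cd.
have c1 : c <> 1 by move=> e; apply: ab; rewrite -ca e act1.
(* An element fixing three points is 1, so [c] fixes at most two. *)
have fixfin : finite_set [set p | act c p = p].
  have [[p cp]|nofix] := pselect (exists p, act c p = p); last first.
    by apply: sub_finite_set (finite_set0 _) => p cp; apply: nofix; exists p.
  have [[q [cq pq]]|one] := pselect (exists q, act c q = q /\ p <> q); last first.
    apply: sub_finite_set (finite_set1 p) => q cq; apply: contrapT => qp.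
    by apply: one; exists q; split=> // e; apply: qp.
  apply: sub_finite_set (finite_set2 p q) => r cr; apply: contrapT => /= /not_orP[rp rq].
  by apply: c1; apply: (same p q r) => //; rewrite ?act1 //; [exact: nesym|exact: nesym].
have Xfin : finite_set [set: X].
  have cfin := finite_image (fun g => act g a) (centralizer_finite c3 c1).
  apply: sub_finite_set (_ : finite_set ([set p | act c p = p] `|`
    ((fun g => act g a) @` [set g | g * c = c * g]))); last by rewrite finite_setU.
  move=> p _; have [cp|cp] := pselect (act c p = p); [by left|right].
  have c3p : act c (act c (act c p)) = p by rewrite -!actM // ?mulgA c3 act1.
  have c12 : act c p <> act c (act c p).
    by move=> e; apply: cp; rewrite -[in RHS]c3p -!e.
  have c02 : p <> act c (act c p).
    by move=> e; apply: cp; rewrite [in LHS]e c3p.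
  (* The element sending [a, b, d] to the orbit of [p] under [c] commutes with [c], because [g * c]
     and [c * g] agree on these three points. *)
  have [g [Gg ga gb gd]] := tr3 _ _ _ _ _ _ ab bd ad (nesym cp) c12 c02.
  exists g => //=; apply: (same _ _ _ _ _ ab bd ad); rewrite ?actM //.
  - exact: GM.
  - exact: GM.
  - by rewrite ca ga gb.
  - by rewrite cb gb gd.
  - by rewrite cd ga gd c3p.
apply: (@finite_set_injective _ _ _ ([set: X] `*` [set: X] `*` [set: X])
  (fun g => (act g a, act g b, act g d))) => //.
  by move=> g h Gg Gh [ea eb ed]; exact: same ab bd ad _ _ _ _ _.
by do 2 ?apply: finite_setX.
Qed.

Theorem theorem1p4 :
  (exists G : set (SL 4 int), subgroup G /\ nonsplit_sharply3_transitive G) /\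
  ~ (exists G : set (SL 3 int),
        [/\ subgroup G, infinite_set G & sharply_transitive 3 G]).
Proof.
split; first exact: nonsplit_of_free sl_iota1 sl_iotaM sl_compatible sl_free.
by move=> [G [Gsub Ginf Gtr]]; apply: Ginf; exact: sharply3_finite.
Qed.
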